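(* Let $d\ge 3$ and let $\eta$ be an $\mathbb{N}$-valued random variable with $\mathbf{P}[\eta\ge1]>0$. If $\mathbf{E}\,\eta^\delta=\infty$ for every $\delta>0$, then $p_c(\mathbb{T}_d,\eta)=0$.
   Context: Here $\mathbb{N}=\{0,1,2,\dots\}$, and $\mathbb{T}_d$ denotes the infinite homogeneous tree in which every vertex has degree $d$, with a fixed root $\mathbf{0}$. Frog model $\mathrm{FM}(\mathcal{G},p,\eta)$. Let $\mathcal{G}$ be an infinite connected undirected graph all of whose sites (vertices) have finite degree, with a fixed site $\mathbf{0}$ called the root; let $p\in[0,1]$ and let $\eta$ be a random variable with values in $\mathbb{N}$. Let $\{\eta(x)\}_{x}$, $\{(S^x_n(i))_{n\in\mathbb{N}}\}_{x,\,i\ge1}$, $\{\Xi^x_p(i)\}_{x,\,i\ge 1}$ be independent families of independent random variables, where $\eta(x)$ has the law of $\eta$, $(S^x_n(i))_n$ is a discrete-time simple random walk on $\mathcal{G}$ started from $x$, and $\mathbf{P}[\Xi^x_p(i)=k]=(1-p)p^{k-1}$, $k=1,2,\dots$ (for $p=1$, $\Xi^x_p(i)=\infty$, no death). Site $x$ initially contains $\eta(x)$ particles; at time $0$ all particles are sleeping except those at the root, which are active. If the particles of site $x$ are activated at time $T(x)$, the $i$-th of them ($1\le i\le\eta(x)$) is active and located at $S^x_n(i)$ at time $T(x)+n$ for $0\le n<\Xi^x_p(i)$, and then disappears. When an active particle visits a site, all sleeping particles there become active. Formally, $t(x,y)=\min_{1\le i\le\eta(x)}\min\{n<\Xi^x_p(i):S^x_n(i)=y\}$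 for $x\ne y$ ($\infty$ if there is no such $n$), and $T(x)=\inf\{t(x_0,x_1)+\dots+t(x_{m-1},x_m)\}$ over all finite sequences $\mathbf{0}=x_0,x_1,\dots,x_m=x$, with $T(\mathbf{0})=0$; $T(x)=\infty$ means that $x$ is never visited by active particles. The model survives if at every time there is at least one active particle; otherwise it dies out. The critical parameter is $p_c(\mathcal{G},\eta)=\inf\{p\in[0,1]:\mathbf{P}[\mathrm{FM}(\mathcal{G},p,\eta)\text{ survives}]>0\}$. *)

(* Defs.v *)
From HB Require Import structures.
From mathcomp Require Import all_boot all_order all_algebra finmap.
From mathcomp Require Import all_classical all_reals all_analysis measurable_realfun.

Set Implicit Arguments.
Unset Strict Implicit.
Unset Printing Implicit Defensive.

Import Order.TTheory GRing.Theory Num.Theory.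
Import numFieldNormedType.Exports.

Local Open Scope classical_set_scope.
Local Open Scope ring_scope.

(* Local finiteness is built in: the neighbourhood of a vertex is a finite set. *)
Record graph := Graph {
  vertex :> choiceType;
  nbr : vertex -> {fset vertex};
  nbr_sym : forall x y : vertex, (y \in nbr x) = (x \in nbr y);
  nbr_irr : forall x : vertex, x \notin nbr x;
  graph_connected : forall x y : vertex,
    exists2 s : seq vertex, path (fun u v => v \in nbr u) x s & last x s = y;
  graph_infinite : infinite_set [set: vertex]
}.

Definition adj (G : graph) : rel G := fun x y => y \in nbr x.

Definition deg (G : graph) (x : G) : nat := #|` nbr x|.

(* [ucycle] also holds of the sequences [:: x; y] with x and y adjacent,
   whence the bound 2. *)
Definition acyclic (G : graph) : Prop :=
  forall c : seq G, ucycle (@adj G) c -> (size c <= 2)%N.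

(* Connectedness is part of [graph], so this says that G is (isomorphic to) T_d. *)
Definition homogeneous_tree (d : nat) (G : graph) : Prop :=
  acyclic G /\ forall x : G, deg x = d.

(* In the next definitions eta, S and Xi are one outcome of the random sources.
   The particles of site x are numbered from 0, i.e. those with index i < eta x.
   Times take values in \bar R, with +oo for "never". *)
Definition hitting_times (R : realType) (G : graph) (eta : G -> nat)
    (S : G -> nat -> nat -> G) (Xi : G -> nat -> \bar R) (x y : G) :
    set (\bar R) :=
  [set t | exists i n : nat,
     [/\ (i < eta x)%N, (n%:R%:E < Xi x i)%E, S x i n = y & t = n%:R%:E]].

(* t(x, y); the infimum of the empty set is +oo *)
Definition passage_time (R : realType) (G : graph) (eta : G -> nat)
    (S : G -> nat -> nat -> G) (Xi : G -> nat -> \bar R) (x y : G) : \bar R :=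
  ereal_inf (hitting_times eta S Xi x y).

(* T(x); t(x, y) is only meant for x != y, so consecutive sites are distinct.
   The sequence [::] gives T(root) = 0. *)
Definition activation_time (R : realType) (G : graph) (root : G)
    (eta : G -> nat) (S : G -> nat -> nat -> G) (Xi : G -> nat -> \bar R)
    (x : G) : \bar R :=
  ereal_inf [set t | exists s : seq G,
    [/\ path (fun u v => u != v) root s, last root s = x &
        t = (\sum_(u <- pairmap (passage_time eta S Xi) root s) u)%E]].

Definition active_at (R : realType) (G : graph) (root : G)
    (eta : G -> nat) (S : G -> nat -> nat -> G) (Xi : G -> nat -> \bar R)
    (x : G) (i n : nat) : Prop :=
  (i < eta x)%N /\
  exists2 k : nat, (activation_time root eta S Xi x + k%:R%:E = n%:R%:E)%E &
                   (k%:R%:E < Xi x i)%E.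

Definition survives (R : realType) (G : graph) (root : G)
    (eta : G -> nat) (S : G -> nat -> nat -> G) (Xi : G -> nat -> \bar R) :
    Prop :=
  forall n : nat, exists (x : G) (i : nat), active_at root eta S Xi x i n.

Definition mutually_independent (R : realType) (d : measure_display)
    (Omega : measurableType d) (P : probability Omega R) (I : choiceType)
    (F : I -> set (set Omega)) : Prop :=
  forall (J : {fset I}) (E : I -> set Omega),
    (forall j, j \in J -> F j (E j)) ->
    P (\bigcap_(j in [set` J]) E j) = (\prod_(j <- J) P (E j))%E.

Definition srw_kernel (R : realType) (G : graph) (x y : G) : R :=
  if y \in nbr x then (deg x)%:R^-1 else 0.

Definition is_simple_random_walk (R : realType) (d : measure_display)
    (Omega : measurableType d) (P : probability Omega R) (G : graph) (x : G)
    (S : nat -> Omega -> G) : Prop :=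
  [/\ forall (n : nat) (A : set G), measurable (S n @^-1` A),
      P [set w | S 0%N w = x] = 1%E &
      forall (n : nat) (v : nat -> G),
        P [set w | forall k, (k <= n.+1)%N -> S k w = v k] =
        (P [set w | forall k, (k <= n)%N -> S k w = v k]
         * (srw_kernel R (v n) (v n.+1))%:E)%E].

(* P[Xi = k] = (1 - p) p^(k-1) for k >= 1, and Xi = +oo when p = 1 *)
Definition is_lifetime (R : realType) (d : measure_display)
    (Omega : measurableType d) (P : probability Omega R) (p : R)
    (Xi : Omega -> \bar R) : Prop :=
  (forall k : nat,
     P [set w | Xi w = k.+1%:R%:E] = ((1 - p) * p ^+ k)%:E) /\
  (p = 1 -> P [set w | Xi w = +oo%E] = 1%E).

(* One index per site for the initial numbers of particles, one per particle
   for the walks and one per particle for the lifetimes. *)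
Definition source_index (G : graph) : choiceType :=
  (G + (G * nat) + (G * nat))%type.

(* The sigma-algebra generated by each random source; a walk is one source,
   and sites carry the discrete sigma-algebra. *)
Definition source_sigma (R : realType) (d : measure_display)
    (Omega : measurableType d) (G : graph) (eta : G -> Omega -> nat)
    (S : G -> nat -> nat -> Omega -> G) (Xi : G -> nat -> Omega -> \bar R)
    (j : source_index G) : set (set Omega) :=
  match j with
  | inl (inl x) => preimage_set_system setT (eta x) (@measurable _ nat)
  | inl (inr (x, i)) =>
      <<s \bigcup_n preimage_set_system setT (S x i n) [set: set G] >>
  | inr (x, i) => preimage_set_system setT (Xi x i) (@measurable _ (\bar R))
  end.

(* A realization of FM(G, p, eta) on some probability space; eta0 is the
   prescribed random variable, possibly living on another probability space. *)
Record frog_model (R : realType) (G : graph) (p : R) (d0 : measure_display)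
    (Omega0 : measurableType d0) (P0 : probability Omega0 R)
    (eta0 : {RV P0 >-> nat}) := FrogModel {
  fm_display : measure_display;
  fm_space : measurableType fm_display;
  fm_prob : probability fm_space R;
  fm_eta : G -> {RV fm_prob >-> nat};
  fm_walk : G -> nat -> nat -> fm_space -> G;
  fm_lifetime : G -> nat -> {RV fm_prob >-> \bar R};
  fm_eta_law : forall (x : G) (A : set nat),
    distribution fm_prob (fm_eta x) A = distribution P0 eta0 A;
  fm_walk_law : forall (x : G) (i : nat),
    is_simple_random_walk fm_prob x (fm_walk x i);
  fm_lifetime_law : forall (x : G) (i : nat),
    is_lifetime fm_prob p (fm_lifetime x i);
  fm_independent : mutually_independent fm_prob
    (source_sigma fm_eta fm_walk fm_lifetime)
}.

Arguments fm_eta {R G p d0 Omega0 P0 eta0} f _.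
Arguments fm_prob {R G p d0 Omega0 P0 eta0} f.
Arguments fm_walk {R G p d0 Omega0 P0 eta0} f _ _ _ _.
Arguments fm_lifetime {R G p d0 Omega0 P0 eta0} f _ _.

Definition survival_event (R : realType) (G : graph) (root : G) (p : R)
    (d0 : measure_display) (Omega0 : measurableType d0)
    (P0 : probability Omega0 R) (eta0 : {RV P0 >-> nat})
    (M : frog_model G p eta0) : set (fm_space M) :=
  [set w | survives root (fun x => fm_eta M x w)
             (fun x i n => fm_walk M x i n w) (fun x i => fm_lifetime M x i w)].

Arguments survival_event {R G} root {p d0 Omega0 P0 eta0} M _.

(* The survival probability depends only on G, root, p and the law of eta0,
   so it does not matter which realization is used; one is required to exist. *)
Definition survives_with_positive_probability (R : realType) (G : graph)
    (root : G) (p : R) (d0 : measure_display) (Omega0 : measurableType d0)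
    (P0 : probability Omega0 R) (eta0 : {RV P0 >-> nat}) : Prop :=
  exists M : frog_model G p eta0, (0 < fm_prob M (survival_event root M))%E.

(* Taken in \bar R, where the infimum of the empty set is +oo (and not 0). *)
Definition critical_parameter (R : realType) (G : graph) (root : G)
    (d0 : measure_display) (Omega0 : measurableType d0)
    (P0 : probability Omega0 R) (eta0 : {RV P0 >-> nat}) : \bar R :=
  ereal_inf [set p%:E | p in [set p : R | 0 <= p <= 1 /\
    survives_with_positive_probability root p eta0]].

(* Main.v *)
(* Fix 0 < p < 1. A particle walks straight to a given vertex at distance L,
   and is still active on arrival, with probability at least
   rho = (1 - p) (p / d)^L. Hence if x carries K = c^L particles, c being a large
   constant, then with probability at least 1/2 every one of 2^L descendants of x
   at distance L is visited by one of them. The moment condition makes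
   P[eta >= c^L] at least 4 / 2^L for some L. Call a vertex good if it carries at
   least K particles and its first K particles visit all these descendants: on
   the 2^L-ary tree of the selected descendants, goodness is an independent site
   percolation of parameter at least 2 / 2^L, which survives with positive
   probability. Infinitely many vertices are then activated at finite but
   unbounded times, which forces an active particle at each time.
   Since a realization must be exhibited, all random sources are built from one
   uniform variable on [0, 1[ by generalized digit expansions. *)

From HB Require Import structures.
Require Import Defs.
From mathcomp Require Import all_boot all_order all_algebra finmap.
From mathcomp Require Import all_classical all_reals all_analysis measurable_realfun lra ring.

Set Implicit Arguments.
Unset Strict Implicit.
Unset Printing Implicit Defensive.

Import Order.TTheory GRing.Theory Num.Theory.
Import numFieldNormedType.Exports.

Local Open Scope classical_set_scope.
Local Open Scope ring_scope.

(** * Independent sequences on the unit interval *)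

(** The pushforward of Lebesgue measure under the affine map, divided by [m], agrees with Lebesgue
    measure on the intervals []a, b]], hence everywhere by uniqueness. *)
Lemma lebesgue_measure_affine (R : realType) (m c : R) (X : set R) :
  0 < m -> measurable X ->
  lebesgue_measure ((fun x => (x - c) / m) @^-1` X) =
  (m%:E * lebesgue_measure X)%E.
Proof.
move=> m0 mX.
pose f : measurableTypeR R -> measurableTypeR R := fun x => (x - c) / m.
have mf : measurable_fun [set: measurableTypeR R] f.
  apply: measurable_funM => //; exact: measurable_funB.
have im0 : 0 <= m^-1 by rewrite invr_ge0 ltW.
have [nu nuE'] : exists nu : {measure set (measurableTypeR R) -> \bar R},
    forall E, nu E = (m^-1%:E * lebesgue_measure (f @^-1` E))%E.
  pose nu0 : {measure set _ -> \bar R} :=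
    mscale (NngNum im0) (pushforward (@lebesgue_measure R) f).
  by exists (nu0 mf).
have nuE : lebesgue_measure X = nu X.
  apply: lebesgue_measure_unique => // _ [[a b] _ <-].
  rewrite nuE'.
  rewrite (_ : f @^-1` _ = [set` `]m * a + c, m * b + c]]); last first.
    apply/seteqP; split=> x; rewrite /f /= !in_itv/= ltr_pdivlMr// ler_pdivrMr//
      ltrBrDr lerBlDr; rewrite !(mulrC m); exact.
  rewrite !lebesgue_measure_itv /= !lte_fin ltrD2r ltr_pM2l//.
  case: ifP => _; last by rewrite mule0.
  rewrite -!EFinB -EFinM; congr EFin.
  by rewrite opprD addrACA subrr addr0 -mulrBr mulKf// gt_eqF.
by rewrite nuE nuE' muleA -EFinM mulfV ?gt_eqF// mul1e.
Qed.

(** * One digit of a uniform point, and the remainder *)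

Section digit.
Variables (R : realType) (m : nat -> R).
Hypothesis m_ge0 : forall k, 0 <= m k.
Hypothesis m_sum : (\sum_(0 <= k <oo) (m k)%:E = 1)%E.

Definition cumul (n : nat) : R := \sum_(k < n) m k.

Lemma cumulS n : cumul n.+1 = cumul n + m n.
Proof. by rewrite /cumul big_ord_recr. Qed.

Lemma cumul_ge0 n : 0 <= cumul n.
Proof. exact: sumr_ge0. Qed.

Lemma cumul_le n k : (n <= k)%N -> cumul n <= cumul k.
Proof.
elim: k => [|k IH]; first by rewrite leqn0 => /eqP ->.
rewrite leq_eqVlt => /predU1P[->//|/IH/le_trans]; apply.
by rewrite cumulS lerDl.
Qed.

Lemma cumul_le1 n : cumul n <= 1.
Proof.
rewrite -lee_fin -m_sum /cumul -sumEFin -(big_mkord xpredT (fun k => (m k)%:E)).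
by apply: nneseries_lim_ge => k _; rewrite lee_fin.
Qed.

Lemma cumul_gt x : x < 1 -> exists n, x < cumul n.
Proof.
move=> x1; apply: contrapT => /forallNP nx.
have : (1 <= x%:E :> \bar R)%E.
  rewrite -m_sum; apply: lime_le.
    by apply: is_cvg_nneseries => k _ _; rewrite lee_fin.
  apply: nearW => n; rewrite /= big_mkord sumEFin lee_fin leNgt.
  by apply/negP; exact: nx.
by rewrite lee_fin leNgt x1.
Qed.

(* The interval [0, 1[ is cut into consecutive intervals of lengths m 0, m 1,
   etc.; the default value of xget is used outside of [0, 1[. *)
Definition digit (x : R) : nat := xget 0%N [set k | cumul k <= x < cumul k.+1].

(** This blows up the interval containing [x] to the whole of [0, 1[, so that the remainder is again
    a uniform point from which the next digit can be read. *)
Definition rescale (x : R) : R := (x - cumul (digit x)) / m (digit x).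

Lemma digitE x k : cumul k <= x < cumul k.+1 -> digit x = k.
Proof.
move=> xk; rewrite /digit; case: xgetP => [j _ /= xj|/(_ k)]; last by [].
move: xk xj => /andP[xk1 xk2] /andP[xj1 xj2].
apply/eqP; rewrite eqn_leq; apply/andP; split; rewrite leqNgt; apply/negP.
- by move=> /cumul_le kj; have := le_lt_trans xj1 (lt_le_trans xk2 kj); rewrite ltxx.
- by move=> /cumul_le jk; have := le_lt_trans xk1 (lt_le_trans xj2 jk); rewrite ltxx.
Qed.

Lemma digitP x : 0 <= x < 1 -> cumul (digit x) <= x < cumul (digit x).+1.
Proof.
move=> /andP[x0 x1]; have [n nx] := cumul_gt x1.
suff [k xk] : exists k, cumul k <= x < cumul k.+1 by rewrite (digitE xk).
elim: n nx => [|n IH nx]; first by rewrite /cumul big_ord0 ltNge x0.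
have [/IH//|nx'] := ltP x (cumul n).
by exists n; rewrite nx' nx.
Qed.

Lemma measurable_digit (A : set nat) :
  measurable (digit @^-1` A : set (measurableTypeR R)).
Proof.
have m1 k : k != 0%N ->
    measurable (digit @^-1` [set k] : set (measurableTypeR R)).
  move=> k0; rewrite (_ : _ @^-1` _ = [set` `[cumul k, cumul k.+1[]).
    exact: measurable_itv.
  apply/seteqP; split=> x /=; rewrite in_itv/=; last exact: digitE.
  by rewrite /digit; case: xgetP => [j _ /= xj <-//|_ /esym/eqP]; rewrite (negPf k0).
have m2 k : measurable (digit @^-1` [set k] : set (measurableTypeR R)).
  have [->|/m1//] := eqVneq k 0%N.
  (* The value 0 is also the default outside [0, 1[, so its preimage is obtained as the complement
     of all the others. *)
  rewrite (_ : _ @^-1` _ = ~` \bigcup_(k in [set k | k != 0%N]) (digit @^-1` [set k])).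
    apply: measurableC; apply: bigcup_measurable => j /= j0; exact: m1.
  apply/seteqP; split=> x /=; first by move=> x0 [j j0 /= xj]; rewrite -xj x0 in j0.
  by move=> nx; apply: contrapT => /eqP x0; apply: nx; exists (digit x).
rewrite (_ : _ @^-1` _ = \bigcup_(k in A) (digit @^-1` [set k])).
  exact: bigcup_measurable.
apply/seteqP; split=> [x Ax|x [k Ak /= xk]]; first by exists (digit x).
by rewrite xk.
Qed.

Lemma measurable_affine (a b : R) (E : set (measurableTypeR R)) :
  measurable E ->
  measurable ((fun x => (x - a) / b) @^-1` E : set (measurableTypeR R)).
Proof.
move=> mE; rewrite -[X in measurable X]setTI.
have : measurable_fun [set: measurableTypeR R]
    ((fun x => (x - a) / b) : measurableTypeR R -> measurableTypeR R).
  apply: measurable_funM => //; exact: measurable_funB.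
exact.
Qed.

Lemma measurable_rescale (E : set (measurableTypeR R)) :
  measurable E -> measurable (rescale @^-1` E : set (measurableTypeR R)).
Proof.
move=> mE; rewrite (_ : _ @^-1` _ = \bigcup_k (digit @^-1` [set k] `&`
    (fun x => (x - cumul k) / m k) @^-1` E)).
  apply: bigcup_measurable => k _; apply: measurableI.
    exact: measurable_digit.
  exact: measurable_affine.
apply/seteqP; split=> [x Ex|x [k _ [/= <-]]//].
by exists (digit x).
Qed.

Let mu (E : set R) : \bar R := lebesgue_measure (E `&` `[0, 1[%classic).

(** On the piece where the digit is [k], [rescale] is affine with slope [1 / m k] and maps onto [0,
    1[; the piece therefore contributes [m k] times the measure of [E], and these contributions are
    summed over [k] in [A]. *)
Lemma digit_rescale (A : set nat) (E : set (measurableTypeR R)) :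
  measurable E ->
  mu (digit @^-1` A `&` rescale @^-1` E) = (mu (digit @^-1` A) * mu E)%E.
Proof.
move=> mE.
pose S (E : set (measurableTypeR R)) k : set (measurableTypeR R) :=
  digit @^-1` [set k] `&` rescale @^-1` E `&` `[0, 1[%classic.
have mS F k : measurable F -> measurable (S F k).
  move=> mF; apply: measurableI => //; apply: measurableI.
    exact: measurable_digit.
  exact: measurable_rescale.
have SE F k : measurable F -> (lebesgue_measure (S F k) = (m k)%:E * mu F)%E.
  (* A piece of length 0 is empty and is treated apart, the affine change of variables needing a
     nonzero slope. *)
  move=> mF; have := m_ge0 k; rewrite le_eqVlt => /predU1P[mk|mk].
    rewrite -mk mul0e (_ : S F k = set0) ?measure0//.
    apply/seteqP; split=> // x [[/= xk _]]; rewrite in_itv/= => /digitP.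
    by rewrite xk cumulS -mk addr0 => /andP[/le_lt_trans h/h]; rewrite ltxx.
  rewrite -(@lebesgue_measure_affine R (m k) (cumul k))//; last exact: measurableI.
  congr lebesgue_measure; apply/seteqP; split=> x.
    move=> [[/= xk]]; rewrite /rescale xk in_itv/= => Fx x01; split=> //=.
    have := digitP x01; rewrite xk cumulS => /andP[h1 h2].
    by rewrite in_itv/= divr_ge0 ?subr_ge0//= ltr_pdivrMr// mul1r ltrBlDl.
  move=> [/= Fx]; rewrite in_itv/= ltr_pdivrMr// mul1r ltrBlDl => /andP[h1 h2].
  have {}h1 : cumul k <= x.
    by move: h1; rewrite ler_pdivlMr// mul0r subr_ge0.
  have xk : digit x = k by apply: digitE; rewrite h1 cumulS.
  split; first by split; rewrite //= /rescale xk.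
  rewrite /= in_itv/= (le_trans (cumul_ge0 k) h1)/=.
  by rewrite (lt_le_trans h2)// -cumulS cumul_le1.
have AE F : measurable F ->
    (mu (digit @^-1` A `&` rescale @^-1` F) =
     \sum_(0 <= k <oo | k \in A) (m k)%:E * mu F)%E.
  move=> mF; rewrite /mu (_ : _ `&` _ `&` _ = \bigcup_(k in A) S F k); last first.
    apply/seteqP; split=> [x [[Ax Fx] x01]|x [k Ak [[/= xk Fx] x01]]].
      by exists (digit x).
    by split=> //; split=> //=; rewrite xk.
  rewrite measure_bigcup//=; first by apply: eq_eseriesr => k _; exact: SE.
  - by move=> k _; exact: mS.
  - by move=> i j _ _ [x [[[/= <- _] _] [[/= <- _] _]]].
have muT : mu setT = 1%E.
  by rewrite /mu setTI lebesgue_measure_itv /= lte_fin ltr01 -EFinB subr0.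
(* [AE] is used a second time with [setT], which computes the measure of the digit event itself. *)
rewrite AE// -(setIT (_ @^-1` A)) -(preimage_setT rescale) (AE setT)// muT.
under [in RHS]eq_eseriesr do rewrite mule1.
have muE : mu E \is a fin_num.
  rewrite ge0_fin_numE ?measure_ge0//; apply: le_lt_trans (_ : 1 < +oo)%E.
    rewrite -muT; apply: le_measure; rewrite ?inE.
    - exact: measurableI.
    - by rewrite setTI; exact: measurable_itv.
    - exact: setSI.
  by rewrite ltry.
rewrite [RHS]muleC -(fineK muE) -nneseriesZl//; first by apply: eq_eseriesr => k _; rewrite muleC.
by move=> k _; rewrite lee_fin.
Qed.

Lemma digit_law k : mu (digit @^-1` [set k]) = (m k)%:E.
Proof.
rewrite /mu (_ : _ `&` _ = `[cumul k, cumul k.+1[%classic).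
  rewrite lebesgue_measure_itv /= lte_fin cumulS ltrDl -EFinB.
  case: ifPn; first by rewrite addrAC subrr add0r.
  by rewrite -leNgt => mk; congr EFin; apply/le_anti; rewrite mk m_ge0.
apply/seteqP; split=> x /=.
  by move=> [<-]; rewrite !in_itv/= => /digitP.
rewrite !in_itv/= => xk; split; first exact: digitE.
move: xk => /andP[h1 h2]; rewrite (le_trans (cumul_ge0 k))//=.
exact: lt_le_trans h2 (cumul_le1 _).
Qed.

End digit.

(** * Sequences of independent digits with prescribed laws *)

Section digits.
Variable R : realType.

Definition unit_measure : set (measurableTypeR R) -> \bar R :=
  mrestr (@lebesgue_measure R) (measurable_itv `[0, 1[).

HB.instance Definition _ := Measure.on unit_measure.

Let unit_measure_setT : unit_measure setT = 1%E.
Proof.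
rewrite /unit_measure /mrestr setTI lebesgue_measure_itv /= lte_fin ltr01.
by rewrite -EFinB subr0.
Qed.

HB.instance Definition _ :=
  Measure_isProbability.Build _ _ _ unit_measure unit_measure_setT.

(* [lebesgue_measure] is defined on all sets as an outer measure, so that
   monotonicity does not require measurability. This is why the measurability
   of the survival event is never needed. *)
Lemma le_unit_measure (A B : set R) :
  A `<=` B -> (unit_measure A <= unit_measure B)%E.
Proof. move=> AB; apply: le_mu_ext; exact: setSI. Qed.

(** A number system in which each digit has its own law; when every [mu j] is uniform on b values,
    this is the base b expansion on [0, 1[. *)
Fixpoint digits (mu : nat -> nat -> R) (j : nat) (x : R) : nat :=
  if j is j'.+1 then digits (fun i => mu i.+1) j' (rescale (mu 0%N) x)
  else digit (mu 0%N) x.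

Lemma measurable_digits (mu : nat -> nat -> R) (j : nat) (A : set nat) :
  (forall i k, 0 <= mu i k) -> (forall i, \sum_(0 <= k <oo) (mu i k)%:E = 1)%E ->
  measurable (digits mu j @^-1` A : set (measurableTypeR R)).
Proof.
elim: j mu => [|j IH] mu mu0 mu1; first exact: measurable_digit.
rewrite (_ : _ @^-1` _ =
  rescale (mu 0%N) @^-1` (digits (fun i => mu i.+1) j @^-1` A))//.
by apply: measurable_rescale => //; exact: IH.
Qed.

Lemma digits_law (mu : nat -> nat -> R) (j k : nat) :
  (forall i k, 0 <= mu i k) -> (forall i, \sum_(0 <= k <oo) (mu i k)%:E = 1)%E ->
  unit_measure (digits mu j @^-1` [set k]) = (mu j k)%:E.
Proof.
elim: j mu => [|j IH] mu mu0 mu1; first exact: digit_law.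
rewrite -(IH (fun i => mu i.+1))//.
(* A void condition on the first digit is inserted, so that [digit_rescale] shows that [rescale]
   preserves the uniform law. *)
transitivity (unit_measure (digit (mu 0%N) @^-1` setT `&`
    rescale (mu 0%N) @^-1` (digits (fun i => mu i.+1) j @^-1` [set k]))).
  by rewrite preimage_setT setTI.
rewrite /unit_measure /mrestr digit_rescale//; last exact: measurable_digits.
rewrite preimage_setT -[X in (X * _)%E]/(unit_measure setT).
by rewrite probability_setT mul1e.
Qed.

(** The first digit is independent of the rescaled point, whose own digits are the remaining ones;
    induction on [n] does the rest. *)
Lemma digits_independent (mu : nat -> nat -> R) (n : nat) (A : nat -> set nat) :
  (forall i k, 0 <= mu i k) -> (forall i, \sum_(0 <= k <oo) (mu i k)%:E = 1)%E ->
  unit_measure [set x | forall j, (j < n)%N -> A j (digits mu j x)] =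
  (\prod_(j < n) unit_measure (digits mu j @^-1` A j))%E.
Proof.
elim: n mu A => [|n IH] mu A mu0 mu1.
  rewrite big_ord0 (_ : [set x | _] = setT) ?probability_setT//.
  by apply/seteqP.
rewrite big_ord_recl.
pose mu' i := mu i.+1.
have mu'0 i k : 0 <= mu' i k by exact: mu0.
have mu'1 i : (\sum_(0 <= k <oo) (mu' i k)%:E = 1)%E by exact: mu1.
have step B E : measurable E -> unit_measure (digit (mu 0%N) @^-1` B `&`
    rescale (mu 0%N) @^-1` E) =
    (unit_measure (digit (mu 0%N) @^-1` B) * unit_measure E)%E.
  exact: digit_rescale.
transitivity (unit_measure (digit (mu 0%N) @^-1` A 0%N `&` rescale (mu 0%N) @^-1`
    [set x | forall j, (j < n)%N -> A j.+1 (digits mu' j x)])).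
  congr unit_measure; apply/seteqP; split=> x /=.
    move=> Ax; split; first exact: (Ax 0%N).
    by move=> j jn; exact: (Ax j.+1).
  by move=> [A0 An] [|j]//; exact: An.
rewrite step; last first.
  rewrite (_ : [set x | _] =
      \bigcap_(j in [set j | (j < n)%N]) (digits mu' j @^-1` A j.+1)).
    by apply: bigcap_measurableType => j _; exact: measurable_digits.
  by apply/seteqP; split=> x Ax j; exact: Ax.
rewrite (IH mu' (fun j => A j.+1))//; congr (_ * _)%E.
apply: eq_bigr => j _.
rewrite -[LHS]mul1e -(probability_setT unit_measure).
rewrite -(preimage_setT (digit (mu 0%N))) -step ?preimage_setT ?setTI//.
exact: measurable_digits.
Qed.

End digits.

(** * Independence of disjoint blocks *)

Definition product_rule (R : realType) (d : measure_display)
    (Omega : measurableType d) (P : probability Omega R) (I : eqType)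
    (Z : I -> Omega -> nat) : Prop :=
  forall (s : seq I) (A : I -> set nat), uniq s ->
  P [set w | forall i, i \in s -> A i (Z i w)] =
  (\prod_(i <- s) P (Z i @^-1` A i))%E.

(** The variable of index [i] is the digit number [enc i] of a single uniform point; injectivity of
    [enc] gives different variables different digits. *)
Lemma exists_product_rule (R : realType) (I : choiceType) (enc : I -> nat)
    (law : I -> nat -> R) :
  injective enc -> (forall i k, 0 <= law i k) ->
  (forall i, \sum_(0 <= k <oo) (law i k)%:E = 1)%E ->
  exists Z : I -> measurableTypeR R -> nat,
    [/\ forall i A, measurable (Z i @^-1` A),
        forall i k, @unit_measure R (Z i @^-1` [set k]) = (law i k)%:E &
        product_rule (@unit_measure R) Z].
Proof.
move=> enc_inj law0 law1.
have [i0|I0] := pselect (exists i : I, True); last first.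
  exists (fun=> fun=> 0%N); split; try by move=> i; case: I0; exists i.
  move=> [|i s] A _; last by case: I0; exists i.
  by rewrite big_nil -(probability_setT (@unit_measure R)); congr unit_measure; apply/seteqP.
have [dec encK] : exists dec : nat -> I, cancel enc dec.
  case: i0 => i0 _.
  exists (fun n => xget i0 [set i | enc i = n]) => i.
  by case: xgetP => [j _ /enc_inj//|/(_ i)]; case.
pose mu n := law (dec n).
have mu0 n k : 0 <= mu n k by exact: law0.
have mu1 n : (\sum_(0 <= k <oo) (mu n k)%:E = 1)%E by exact: law1.
exists (fun i => digits mu (enc i)); split.
- by move=> i A; exact: measurable_digits.
- by move=> i k; rewrite digits_law// /mu encK.
move=> s A us.
(* Digits that code no element of [s] are left unconstrained and contribute a factor 1; [N] below is
   just a bound above all codes of [s]. *)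
pose B n := if n \in map enc s then A (dec n) else setT.
pose N := (\sum_(i <- s) (enc i).+1)%N.
have sN i : i \in s -> (enc i < N)%N.
  move=> si; rewrite /N (big_rem i)//=; exact: leq_addr.
transitivity (unit_measure [set x | forall j, (j < N)%N -> B j (digits mu j x)]).
  congr unit_measure; apply/seteqP; split=> x /= Ax i.
    by move=> _; rewrite /B; case: ifPn => // /mapP[j js ->]; rewrite encK; exact: Ax.
  by move=> si; have := Ax (enc i) (sN _ si); rewrite /B map_f// encK.
rewrite digits_independent// -(big_mkord xpredT (fun j => unit_measure (digits mu j @^-1` B j))).
rewrite (bigID (mem (map enc s)))/= [X in (_ * X)%E]big1 ?mule1; last first.
  move=> j js; rewrite /B (negPf js) preimage_setT; exact: probability_setT.
rewrite -big_filter (perm_big (map enc s)) /=; last first.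
  apply: uniq_perm; rewrite ?map_inj_uniq ?filter_uniq ?iota_uniq//.
  move=> j; rewrite mem_filter mem_index_iota leq0n/=.
  by case: (boolP (j \in _)) => // /mapP[i si ->]; rewrite sN.
rewrite big_map big_seq [RHS]big_seq; apply: eq_bigr => i si.
by rewrite /B map_f// encK.
Qed.

Section blocks.
Context {R : realType} {d : measure_display} {Omega : measurableType d}.
Variables (P : probability Omega R) (I : eqType) (Z : I -> Omega -> nat).
Hypothesis mZ : forall i A, measurable (Z i @^-1` A).
Hypothesis ruleZ : product_rule P Z.

(** A pi-system generating the sigma-algebra of the variables with index in [B]. *)
Definition cylinders (B : set I) : set (set Omega) :=
  [set E | exists (s : seq I) (A : I -> set nat),
    (forall i, i \in s -> B i) /\ E = [set w | forall i, i \in s -> A i (Z i w)]].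

Definition block_sigma (B : set I) : set (set Omega) := <<s cylinders B >>.

Lemma cylindersI (B : set I) : setI_closed (cylinders B).
Proof.
move=> _ _ [s [A [sB ->]]] [s' [A' [sB' ->]]].
exists (s ++ s'), (fun i => [set v | (i \in s -> A i v) /\ (i \in s' -> A' i v)]).
split; first by move=> i; rewrite mem_cat => /orP[/sB|/sB'].
apply/seteqP; split=> w /=.
  move=> [h h'] i; rewrite mem_cat => _; split; [exact: h|exact: h'].
move=> h; split=> i is_; apply (h i); rewrite ?mem_cat ?is_ ?orbT//.
Qed.

Lemma measurable_cylinders (B : set I) E : cylinders B E -> measurable E.
Proof.
move=> [s [A [_ ->]]].
rewrite (_ : [set w | _] = \bigcap_(i in [set` s]) (Z i @^-1` A i)).
  apply: fin_bigcap_measurable; last by move=> i _; exact: mZ.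
  exact: finite_seq.
by [].
Qed.

Lemma measurable_block (B : set I) E : block_sigma B E -> measurable E.
Proof.
apply: smallest_sub; last exact: measurable_cylinders.
exact: sigma_algebra_measurable.
Qed.

Lemma block_sigmaS (B C : set I) : B `<=` C -> block_sigma B `<=` block_sigma C.
Proof.
move=> BC; apply: sub_sigma_algebra2 => _ [s [A [sB ->]]].
by exists s, A; split=> // i /sB /BC.
Qed.

(** Once repetitions are removed, the two disjoint lists concatenate to a single list without
    repetition, and the product over it splits. *)
Lemma cylinders_independent (B C : set I) E F : B `&` C = set0 ->
  cylinders B E -> cylinders C F -> P (E `&` F) = (P E * P F)%E.
Proof.
move=> BC [s [A [sB ->]]] [s' [A' [sC ->]]].
have st i : i \in s' -> i \in s = false.
  by move=> /sC Ci; apply/negP => /sB Bi; have : (B `&` C) i by []; rewrite BC.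
pose A2 i := if i \in s then A i else A' i.
transitivity (P [set w | forall i, i \in undup s ++ undup s' -> A2 i (Z i w)]).
  congr (P _); apply/seteqP; split=> w /=.
    move=> [h h'] i; rewrite mem_cat !mem_undup /A2.
    by case: (boolP (i \in s)) => [si _|_ /= si]; [exact: h|exact: h'].
  move=> h; split=> i is_; have := h i; rewrite mem_cat !mem_undup is_ ?orbT /A2.
    by rewrite is_; exact.
  by rewrite st//; exact.
rewrite ruleZ; last first.
  rewrite cat_uniq !undup_uniq/= andbT; apply/hasPn => i; rewrite !mem_undup.
  by move/st => ->.
rewrite big_cat/=; congr (_ * _)%E.
  transitivity (P [set w | forall i, i \in undup s -> A i (Z i w)]).
    rewrite ruleZ ?undup_uniq// big_seq [RHS]big_seq; apply: eq_bigr => i.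
    by rewrite mem_undup /A2 => ->.
  by congr (P _); apply/seteqP; split=> w /= h i; have := h i; rewrite mem_undup.
transitivity (P [set w | forall i, i \in undup s' -> A' i (Z i w)]).
  rewrite ruleZ ?undup_uniq// big_seq [RHS]big_seq; apply: eq_bigr => i.
  by rewrite mem_undup /A2 => /st ->.
by congr (P _); apply/seteqP; split=> w /= h i; have := h i; rewrite mem_undup.
Qed.

(** Dynkin's argument: the events independent of [F] form a lambda-system, which contains the
    pi-system [G]. *)
Lemma independent_sigma (G : set (set Omega)) (F : set Omega) :
  setI_closed G -> G `<=` measurable -> measurable F ->
  (forall E, G E -> P (E `&` F) = (P E * P F)%E) ->
  forall E, <<s G >> E -> P (E `&` F) = (P E * P F)%E.
Proof.
move=> GI Gm mF GF E GE.
pose H := [set E | measurable E /\ P (E `&` F) = (P E * P F)%E].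
suff /(_ E GE)[] : <<s G >> `<=` H by [].
have finP X : measurable X -> P X \is a fin_num by move=> mX; exact: fin_num_measure.
apply: (@lambda_system_subset _ _ GI setT H) => //; last first.
  by move=> X GX; split; [exact: Gm|exact: GF].
split=> //.
- by split=> //; rewrite setTI probability_setT mul1e.
- move=> X Y YX [mX hX] [mY hY]; split; first exact: measurableD.
  have mXF : measurable (X `&` F) by exact: measurableI.
  have PD (A B : set Omega) : measurable A -> measurable B ->
      P (A `\` B) = (P A - P (A `&` B))%E.
    by move=> mA mB; apply: measureD => //; rewrite ltey_eq finP.
  rewrite setIDAC setIDA PD// PD//.
  rewrite setIAC (setIidr YX) hX hY muleBl//; last 2 first.
  - exact: finP.
  - by rewrite fin_num_adde_defr// finP.
- move=> X ndX HX.
  have mX i : measurable (X i) by case: (HX i).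
  split; first exact: bigcup_measurable.
  rewrite setI_bigcupl.
  (* Both sides of the product formula are limits of the same sequence, by continuity from below. *)
  have c1 : P (X n `&` F) @[n --> \oo] --> P (\bigcup_i (X i `&` F)).
    apply: nondecreasing_cvg_mu => //.
    + by move=> i; exact: measurableI.
    + by apply: bigcup_measurable => i _; exact: measurableI.
    + move=> i j ij; apply/subsetPset; apply: setSI; apply/subsetPset; exact: ndX.
  have c2 : P (X n `&` F) @[n --> \oo] --> (P (\bigcup_i X i) * P F)%E.
    under eq_fun do rewrite (HX _).2.
    apply: cvgeZr; first exact: finP.
    apply: nondecreasing_cvg_mu => //; exact: bigcup_measurable.
  exact: (cvg_unique _ c1 c2).
Qed.

(** Independence is carried from cylinders to the generated sigma-algebras in one argument at a
    time. *)
Lemma block_independent (B C : set I) E F : B `&` C = set0 ->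
  block_sigma B E -> block_sigma C F -> P (E `&` F) = (P E * P F)%E.
Proof.
move=> BC BE CF; apply: (@independent_sigma (cylinders B)) BE.
- exact: cylindersI.
- exact: measurable_cylinders.
- exact: measurable_block CF.
move=> {}E BE; rewrite setIC muleC; apply: (@independent_sigma (cylinders C)) CF.
- exact: cylindersI.
- exact: measurable_cylinders.
- exact: measurable_cylinders BE.
by move=> {}F CF; rewrite setIC muleC; exact: cylinders_independent BE CF.
Qed.

End blocks.

(** * Finite families of blocks, and events determined by finitely many variables *)

Section more_blocks.
Context {R : realType} {d : measure_display} {Omega : measurableType d}.
Variables (P : probability Omega R) (I : eqType) (Z : I -> Omega -> nat).
Hypothesis mZ : forall i A, measurable (Z i @^-1` A).
Hypothesis ruleZ : product_rule P Z.

Lemma block_sigmaT (B : set I) : block_sigma Z B setT.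
Proof.
by apply: sub_sigma_algebra; exists [::], (fun=> setT); split=> //; apply/seteqP.
Qed.

Lemma block_sigmaI (B : set I) E F :
  block_sigma Z B E -> block_sigma Z B F -> block_sigma Z B (E `&` F).
Proof. exact: (@measurableI _ (g_sigma_algebraType (cylinders Z B))). Qed.

Lemma block_sigma_all (L : eqType) (B : set I) (E : L -> set Omega) (s : seq L) :
  (forall l, l \in s -> block_sigma Z B (E l)) ->
  block_sigma Z B [set w | forall l, l \in s -> E l w].
Proof.
elim: s => [_|l s IH sE].
  have -> : [set w | forall l, l \in [::] -> E l w] = setT by apply/seteqP.
  exact: block_sigmaT.
have -> : [set w | forall k, k \in l :: s -> E k w] =
    E l `&` [set w | forall k, k \in s -> E k w].
  apply/seteqP; split=> w /= h.
    by split=> [|k ks]; apply: h; rewrite inE ?eqxx ?ks ?orbT.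
  by move=> k; rewrite inE => /orP[/eqP ->|]; [exact: h.1|exact: h.2].
apply: block_sigmaI; first by apply: sE; exact: mem_head.
by apply: IH => k ks; apply: sE; rewrite inE ks orbT.
Qed.

(** The joint event of the tail of [s] lives on the union of its blocks, which is disjoint from the
    block of the head. *)
Lemma blocks_product (L : eqType) (B : L -> set I) (E : L -> set Omega) (s : seq L) :
  uniq s -> (forall l l', l != l' -> B l `&` B l' = set0) ->
  (forall l, l \in s -> block_sigma Z (B l) (E l)) ->
  P [set w | forall l, l \in s -> E l w] = (\prod_(l <- s) P (E l))%E.
Proof.
move=> us trivB.
elim: s us => [_ _|l s IH /= /andP[ls us] sE].
  have -> : [set w | forall l, l \in [::] -> E l w] = setT by apply/seteqP.
  by rewrite big_nil probability_setT.
have ks_E k : k \in s -> block_sigma Z (B k) (E k).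
  by move=> ks; apply: sE; rewrite inE ks orbT.
have -> : [set w | forall k, k \in l :: s -> E k w] =
    E l `&` [set w | forall k, k \in s -> E k w].
  apply/seteqP; split=> w /= h.
    by split=> [|k ks]; apply: h; rewrite inE ?eqxx ?ks ?orbT.
  by move=> k; rewrite inE => /orP[/eqP ->|]; [exact: h.1|exact: h.2].
rewrite big_cons -(IH us ks_E).
apply: (block_independent mZ ruleZ (C := \bigcup_(k in [set` s]) B k)
  _ (sE l (mem_head _ _))).
  apply/seteqP; split=> // i [Bi [k /= ks Bk]].
  have lk : l != k by apply: contra ls => /eqP ->.
  have : (B l `&` B k) i by [].
  by rewrite trivB.
apply: block_sigma_all => k ks; apply: block_sigmaS (ks_E _ ks).
by move=> i Bi; exists k.
Qed.

Lemma blocks_independent (L : choiceType) (B : L -> set I) :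
  (forall l l', l != l' -> B l `&` B l' = set0) ->
  mutually_independent P (fun l => block_sigma Z (B l)).
Proof.
move=> trivB J E JE; rewrite -(@blocks_product _ B)//; exact: fset_uniq.
Qed.

(* There are only countably many values of (Z i), i in s. *)
Lemma determined_block (B : set I) (s : seq I) (D : set Omega) :
  (forall i, i \in s -> B i) ->
  (forall w w', (forall i, i \in s -> Z i w = Z i w') -> D w -> D w') ->
  block_sigma Z B D.
Proof.
move=> sB detD.
pose C (n : nat) : set Omega := [set w | exists w0,
  [/\ D w0, n = choice.pickle [seq Z i w0 | i <- s] &
      forall i, i \in s -> Z i w = Z i w0]].
have -> : D = \bigcup_(n in [set: nat]) C n.
  apply/seteqP; split=> [w Dw|w [n _ [w0 [Dw0 _ h]]]]; last first.
    by apply: detD Dw0 => i /h.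
  by exists (choice.pickle [seq Z i w | i <- s]) => //; exists w.
have [_ _ sU] := smallest_sigma_algebra setT (cylinders Z B).
apply: sU => n.
have [[w0 [Dw0 nw0]]|no] := pselect (exists w0, D w0 /\
    n = choice.pickle [seq Z i w0 | i <- s]).
  apply: sub_sigma_algebra; exists s, (fun i => [set Z i w0]); split=> //.
  apply/seteqP; split=> w /=; last by exists w0.
  move=> [w1 [_]]; rewrite nw0 => /(pcan_inj choice.pickleK) /eq_in_map h01 h i si.
  by rewrite h// h01.
have -> : C n = set0.
  by apply/seteqP; split=> // w [w0 [Dw0 h _]]; apply: no; exists w0.
exact: sigma_algebra0.
Qed.

End more_blocks.

(** * The tree *)

Section tree.
Variable G : graph.

Fixpoint nonbacktracking (s : seq G) : bool :=
  if s is x :: s' then (if s' is _ :: z :: _ then x != z else true) && nonbacktracking s'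
  else true.

(** By induction only a return to [x] has to be excluded. It closes the cycle [x :: y :: p];
    acyclicity forces [p] to be empty, so the path goes from [x] to [y] and straight back. *)
Lemma nonbacktracking_uniq (x : G) (s : seq G) : acyclic G ->
  path (@adj G) x s -> nonbacktracking (x :: s) -> uniq (x :: s).
Proof.
move=> acG; elim: s x => [//|y s IH] x /= /andP[xy ys] /andP[xz nb].
have /= ups := IH y ys nb; rewrite ups andbT inE negb_or.
have -> /= : x != y by apply: contraTneq xy => <-; rewrite /adj nbr_irr.
apply/negP => xs; case/splitPr: s / xs ys ups xz nb {IH} => p q ys ups xz nb.
have /(acG (x :: y :: p))/= : ucycle (@adj G) (x :: y :: p).
  rewrite /ucycle /= rcons_path xy/=.
  move: ys; rewrite cat_path /= => /and3P[-> -> _] /=.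
  move: ups; rewrite mem_cat cat_uniq /= negb_or inE negb_or.
  move=> /andP[/and3P[-> yx _]] /and3P[-> /norP[xp _] _].
  by rewrite inE negb_or eq_sym yx xp.
by case: p xz {ys ups nb} => [|//]; rewrite /= eqxx.
Qed.

(** Moving the start along [p], and adding the vertices left behind to the front of [q], preserves
    the hypotheses; it ends with a single nonbacktracking path returning to its start, which
    [nonbacktracking_uniq] excludes. *)
Lemma nonbacktracking_last (x : G) (p q : seq G) : acyclic G ->
  path (@adj G) x p -> path (@adj G) x q ->
  nonbacktracking (x :: p) -> nonbacktracking (x :: q) ->
  (forall y z p' q', p = y :: p' -> q = z :: q' -> y != z) ->
  last x p = last x q -> p = [::] /\ q = [::].
Proof.
move=> acG; elim: p x q => [|y p IH] x [|z q] /= xp xq nbp nbq pq.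
- by [].
- move=> xq'; have := nonbacktracking_uniq acG (s := z :: q) xq nbq.
  by rewrite /= {1}xq' mem_last.
- move=> xq'; have := nonbacktracking_uniq acG (s := y :: p) xp nbp.
  by rewrite /= -{1}xq' mem_last.
move=> pq'; have [] // := IH y (x :: z :: q).
- by case/andP: xp.
- by rewrite /= xq andbT /adj nbr_sym; case/andP: xp.
- by case/andP: nbp.
- by rewrite /= (pq y z p q).
- by move=> a b p' q' pE [<- _]; move: nbp; rewrite pE eq_sym => /andP[].
Qed.

(* The first component is the vertex one comes from. *)
Definition tree_step (k : nat) (st : G * G) (c : 'I_k) : G * G :=
  (st.2, nth st.2 (rem st.1 (nbr st.2)) c).

Fixpoint tree_path (k : nat) (st : G * G) (w : seq 'I_k) : seq G :=
  if w is c :: w' then (tree_step st c).2 :: tree_path (tree_step st c) w' else [::].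

Lemma last_tree_path k st (w : seq 'I_k) :
  last st.2 (tree_path st w) = (foldl (@tree_step k) st w).2.
Proof. by elim: w st => //= c w IH st; rewrite -IH. Qed.

Variables (d : nat).
Hypothesis Gd : forall x : G, deg x = d.

(** At most one of the [d] neighbours is removed, so [d.-1] directions are always available. *)
Lemma ltn_size_rem (st : G * G) (c : 'I_d.-1) : (c < size (rem st.1 (nbr st.2)))%N.
Proof.
apply: leq_trans (ltn_ord c) _; rewrite -(Gd st.2) /deg.
have [h|h] := boolP (st.1 \in (nbr st.2 : seq G)); first by rewrite size_rem.
by rewrite rem_id// leq_pred.
Qed.

Lemma tree_step_mem (st : G * G) (c : 'I_d.-1) :
  (tree_step st c).2 \in nbr st.2 /\ (tree_step st c).2 != st.1.
Proof.
have := mem_nth st.2 (ltn_size_rem st c).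
by rewrite mem_rem_uniq ?fset_uniq// inE => /andP[].
Qed.

Lemma tree_path_adj st (w : seq 'I_d.-1) :
  path (@adj G) st.2 (tree_path st w) /\
  nonbacktracking (st.1 :: st.2 :: tree_path st w).
Proof.
elim: w st => [//|c w IH] st; have [h1 h2] := IH (tree_step st c).
have [h3 h4] := tree_step_mem st c.
rewrite [tree_path _ _]/=; split; first by rewrite /= [adj _ _]h3.
by move: h2; rewrite /= eq_sym h4.
Qed.

(** Common initial letters are stripped off; at the first difference the two paths part, the list of
    directions having no repetition, and [nonbacktracking_last] keeps their ends apart. *)
Lemma tree_foldl_inj st : acyclic G ->
  injective (fun w : seq 'I_d.-1 => (foldl (@tree_step _) st w).2).
Proof.
move=> acG w w'; rewrite -!last_tree_path.
have nbP st' (v : seq 'I_d.-1) : nonbacktracking (st'.2 :: tree_path st' v).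
  by have [_ /andP[]] := tree_path_adj st' v.
elim: w w' st => [|c w IH] [|c' w'] st //.
- move=> /(nonbacktracking_last acG) []//; first exact: (tree_path_adj _ _).1.
- move=> /(nonbacktracking_last acG) []//; first exact: (tree_path_adj _ _).1.
have [->|cc'] := eqVneq c c'.
  by move=> /= /IH ->.
move=> /(nonbacktracking_last acG) []//; try exact: (tree_path_adj _ _).1.
- move=> y z p q [<- _] [<- _]; rewrite /tree_step /=.
  by rewrite nth_uniq ?ltn_size_rem ?rem_uniq ?fset_uniq.
Qed.

Lemma binary_tree_embedding (root : G) : (3 <= d)%N -> acyclic G ->
  exists V : seq bool -> G, [/\ V [::] = root,
    forall w c, V (rcons w c) \in nbr (V w) & injective V].
Proof.
move=> d3 acG.
have d1 (c : bool) : (c < d.-1)%N by move: c d3; case: (d) => [|[|[|d']]] // [].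
pose f c := Ordinal (d1 c).
have f_inj : injective f by move=> [] [] // /(congr1 val).
(* The root serves as its own predecessor; as it is not its own neighbour, [rem] removes nothing
   there. *)
exists (fun w => (foldl (@tree_step _) (root, root) (map f w)).2); split => //.
  move=> w c; rewrite map_rcons foldl_rcons; exact: (tree_step_mem _ _).1.
exact: inj_comp (tree_foldl_inj acG) (inj_map f_inj).
Qed.

(** * Balls as finite lists, and countability of the graph *)

Fixpoint graph_ball (x : G) (n : nat) : seq G :=
  if n is n'.+1 then graph_ball x n' ++ flatten [seq (nbr y : seq G) | y <- graph_ball x n']
  else [:: x].

Lemma graph_ballS x n : {subset graph_ball x n <= graph_ball x n.+1}.
Proof. by move=> y; rewrite /= mem_cat => ->. Qed.

Lemma graph_ball_step x n y z : y \in graph_ball x n -> z \in nbr y -> z \in graph_ball x n.+1.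
Proof.
move=> yn zy; rewrite /= mem_cat; apply/orP; right; apply/flattenP.
by exists (nbr y : seq G) => //; apply: map_f.
Qed.

Lemma graph_ball_path x s n : path (@adj G) x s -> (size s <= n)%N -> last x s \in graph_ball x n.
Proof.
elim/last_ind: s n => [|s y IH] n.
  by move=> _ _; elim: n => [|n IH]; [rewrite inE|exact: graph_ballS].
rewrite rcons_path size_rcons last_rcons => /andP[xs ys]; case: n => // n sn.
exact: graph_ball_step (IH _ xs sn) ys.
Qed.

(** Connectedness makes the graph a countable union of finite balls; a vertex is coded by a radius
    and its position in the list of that ball. *)
Lemma graph_enc : exists enc : G -> nat, injective enc.
Proof.
have [[x _]|noG] := pselect (exists x : G, True); last first.
  by exists (fun=> 0%N) => x; case: noG; exists x.
have h (y : G) : exists n, y \in graph_ball x n.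
  by have [s xs <-] := graph_connected x y; exists (size s); exact: graph_ball_path.
have [f hf] := choice h.
exists (fun y => choice.pickle (f y, index y (graph_ball x (f y)))) => y z.
move=> /(pcan_inj choice.pickleK) [fyz]; rewrite -fyz => iyz.
by rewrite -(nth_index x (hf y)) iyz nth_index// fyz.
Qed.

End tree.

(** * Chains of activations *)

Section deterministic.
Context {R : realType} {G : graph}.

Definition nat_or_infty (t : \bar R) : Prop :=
  t = +oo%E \/ exists n : nat, t = n%:R%:E.

(** By well-ordering a finite infimum is attained, so finite passage and activation times come from
    an actual particle or sequence of sites. *)
Lemma ereal_inf_nat (A : set (\bar R)) : A `<=` nat_or_infty ->
  ereal_inf A = +oo%E \/ exists2 n : nat, A n%:R%:E & ereal_inf A = n%:R%:E.
Proof.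
move=> An.
have [[n0 An0]|no] := pselect (exists n : nat, A n%:R%:E); [right|left].
  have exA : exists n : nat, `[< A n%:R%:E >] by exists n0; apply/asboolP.
  exists (ex_minn exA); first by case: ex_minnP => m /asboolP.
  case: ex_minnP => m /asboolP Am mmin; apply/le_anti/andP; split.
    exact: ereal_inf_lbound.
  apply/ereal_infP => t At; have [->|[k tk]] := An _ At; first exact: leey.
  by rewrite tk lee_fin ler_nat; apply: mmin; apply/asboolP; rewrite -tk.
apply/eqP; rewrite -leye_eq; apply/ereal_infP => t At.
by have [->|[k tk]] := An _ At; last by case: no; exists k; rewrite -tk.
Qed.

Variables (root : G) (eta : G -> nat) (S : G -> nat -> nat -> G) (Xi : G -> nat -> \bar R).

Let t := passage_time eta S Xi.
Let T := activation_time root eta S Xi.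

Definition hits (x y : G) : Prop :=
  exists i n : nat, [/\ (i < eta x)%N, (n%:R%:E < Xi x i)%E & S x i n = y].

Lemma passage_timeP (x y : G) : t x y = +oo%E \/
  exists i n : nat, [/\ (i < eta x)%N, (n%:R%:E < Xi x i)%E, S x i n = y & t x y = n%:R%:E].
Proof.
have [|tE|[n [i [m [h1 h2 h3 h4]]] tE]] := @ereal_inf_nat (hitting_times eta S Xi x y).
- by move=> _ [i [n [_ _ _ ->]]]; right; exists n.
- by left.
- move/eqP: h4; rewrite eqe eqr_nat => /eqP nm; right; exists i, m; split=> //.
  by rewrite /t /passage_time tE nm.
Qed.

Lemma hits_passage_time (x y : G) : hits x y -> (t x y < +oo)%E.
Proof.
move=> [i [n [h1 h2 h3]]]; apply: le_lt_trans (_ : n%:R%:E < +oo)%E; last exact: ltry.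
by apply: ereal_inf_lbound; exists i, n.
Qed.

Lemma passage_time_nat (x y : G) : nat_or_infty (t x y).
Proof.
by case: (passage_timeP x y) => [->|[i [n [_ _ _ ->]]]]; [left|right; exists n].
Qed.

Lemma nat_or_inftyD (u v : \bar R) : nat_or_infty u -> nat_or_infty v ->
  nat_or_infty (u + v)%E.
Proof.
move=> [->|[n ->]] [->|[m ->]]; try by left.
by right; exists (n + m)%N; rewrite natrD.
Qed.

Lemma sum_passage_time_nat (x : G) (s : seq G) :
  nat_or_infty (\sum_(u <- pairmap t x s) u)%E.
Proof.
elim: s x => [|y s IH] x /=; first by rewrite big_nil; right; exists 0%N.
by rewrite big_cons; apply: nat_or_inftyD; [exact: passage_time_nat|exact: IH].
Qed.

Lemma activation_timeP (x : G) : T x = +oo%E \/ exists2 n : nat, T x = n%:R%:E &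
  exists s : seq G, [/\ path (fun u v => u != v) root s, last root s = x &
    (\sum_(u <- pairmap t root s) u)%E = n%:R%:E].
Proof.
have [|TE|[n [s [h1 h2 h3]] TE]] := @ereal_inf_nat [set t | exists s : seq G,
    [/\ path (fun u v => u != v) root s, last root s = x &
        t = (\sum_(u <- pairmap (passage_time eta S Xi) root s) u)%E]].
- by move=> _ [s [_ _ ->]]; exact: sum_passage_time_nat.
- by left.
- by right; exists n => //; exists s.
Qed.

Lemma activation_time_root : (T root <= 0)%E.
Proof. by apply: ereal_inf_lbound; exists [::]; split=> //=; rewrite big_nil. Qed.

Lemma activation_time_step (x y : G) : x != y -> (T x < +oo)%E ->
  (T y <= T x + t x y)%E.
Proof.
move=> xy; have [->|[n TE [s [h1 h2 h3]]]] := activation_timeP x; first by rewrite ltxx.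
move=> _; apply: ereal_inf_lbound; exists (rcons s y); split.
- by rewrite rcons_path h1 h2.
- by rewrite last_rcons.
- by rewrite -cats1 pairmap_cat /= h2 big_cat/= big_seq1 h3 TE.
Qed.

Hypothesis S0 : forall x i, S x i 0%N = x.
Hypothesis SS : forall x i n, S x i n.+1 = S x i n \/ S x i n.+1 \in nbr (S x i n).

Lemma walk_graph_ball (x : G) (i n k : nat) :
  x \in graph_ball root k -> S x i n \in graph_ball root (k + n).
Proof.
move=> xk; elim: n => [|n IH]; first by rewrite S0 addn0.
rewrite addnS; case: (SS x i n) => [->|h]; first exact: graph_ballS.
exact: graph_ball_step IH h.
Qed.

(** Walks move by at most one edge per unit of time, so the radius grows by at most the total
    time. *)
Lemma sum_passage_time_ball (x : G) (s : seq G) (k n : nat) : x \in graph_ball root k ->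
  (\sum_(u <- pairmap t x s) u)%E = n%:R%:E -> last x s \in graph_ball root (k + n).
Proof.
elim: s x k n => [|y s IH] x k n xk /=.
  rewrite big_nil => /esym/eqP; rewrite eqe pnatr_eq0 => /eqP ->.
  by rewrite addn0.
rewrite big_cons; case: (passage_timeP x y) => [->|[i [m [_ _ Sy ->]]]].
  by case: (sum_passage_time_nat y s) => [->|[? ->]].
case: (sum_passage_time_nat y s) => [->//|[p sp]].
rewrite sp -EFinD -natrD => /eqP; rewrite eqe eqr_nat => /eqP <-.
by rewrite addnA; apply: IH sp; rewrite -Sy; exact: walk_graph_ball.
Qed.

Lemma graph_ball_mono m n : (m <= n)%N -> {subset graph_ball root m <= graph_ball root n}.
Proof.
elim: n => [|n IH]; first by rewrite leqn0 => /eqP ->.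
rewrite leq_eqVlt => /predU1P[->//|/IH h] y /h; exact: graph_ballS.
Qed.

Lemma activation_time_ball (x : G) (n : nat) : (T x <= n%:R%:E)%E -> x \in graph_ball root n.
Proof.
case: (activation_timeP x) => [->//|[m -> [s [_ <- sm]]]].
rewrite lee_fin ler_nat => mn; apply: (graph_ball_mono mn); rewrite -(add0n m).
by apply: sum_passage_time_ball sm; rewrite inE.
Qed.

(** A chain with more vertices than the ball of radius [n] leaves that ball, so one of its vertices
    is not activated by time [n]. Along the chain some [u] activated by time [n] precedes some [v]
    activated later, and the particle of [u] that first reaches [v] is active at time [n]. *)
Lemma survives_chains :
  (forall k, exists s : seq G, [/\ size s = k, uniq (root :: s) &
     path (fun x y => `[< hits x y >]) root s]) ->
  survives root eta S Xi.
Proof.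
move=> chains n; have [s [sk us hs]] := chains (size (graph_ball root n)).
have [z zs zb] : exists2 z, z \in root :: s & z \notin graph_ball root n.
  apply: contrapT => no; have : (size (root :: s) <= size (graph_ball root n))%N.
    apply: uniq_leq_size us _ => z zs; apply: contrapT => /negP zb.
    by apply: no; exists z.
  by rewrite /= sk ltnn.
have nz : (n%:R%:E < T z)%E.
  rewrite ltNge; apply: contra zb; exact: activation_time_ball.
suff [u [v [uv huv Tu Tv]]] : exists u v, [/\ u != v, hits u v,
    (T u <= n%:R%:E)%E & (n%:R%:E < T v)%E].
  case: (activation_timeP u) => [Tuoo|[a Ta _]]; first by rewrite Tuoo in Tu.
  have an : (a <= n)%N by move: Tu; rewrite Ta lee_fin ler_nat.
  have Tuv : (T v <= T u + t u v)%E by apply: activation_time_step; rewrite // Ta ltry.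
  case: (passage_timeP u v) => [tuv|[i [p [ie pX _ tp]]]].
    by have := hits_passage_time huv; rewrite tuv.
  (* The age [n - a] of the particle is at most its hitting time [p] of [v], since [n] is less than
     [a + p]. *)
  exists u, i; split=> //; exists (n - a)%N.
    by rewrite -/(T u) Ta -EFinD -natrD subnKC.
  apply: le_lt_trans pX; rewrite lee_fin ler_nat.
  have := lt_le_trans Tv Tuv; rewrite Ta tp -EFinD -natrD lte_fin ltr_nat.
  by move=> h; rewrite leq_subLR; exact: ltnW.
have T0 : (T root <= n%:R%:E)%E.
  by apply: le_trans activation_time_root _; rewrite lee_fin.
(* The start of the chain varies in the induction, subject to being activated by time [n]. *)
elim: s (root) T0 us hs zs {sk} => [|y s IH] x Tx us hs.
  by rewrite inE => /eqP zx; move: nz; rewrite zx ltNge Tx.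
rewrite inE => /predU1P[zx|zs]; first by move: nz; rewrite zx ltNge Tx.
have /= /andP[/asboolP hxy {}hs] := hs.
have [Ty|Ty] := leP (T y) n%:R%:E; first by apply: (IH y) => //; case/andP: us.
exists x, y; split=> //.
by move: us => /= /andP[]; rewrite inE negb_or => /andP[].
Qed.

End deterministic.

(** * The tail of the number of particles *)

(* Otherwise the tails P[eta >= c^n] < 4 / 2^n make E eta^delta finite for the
   delta with c^delta = 3/2. *)
Lemma heavy_tail (R : realType) (d0 : measure_display)
    (Omega0 : measurableType d0) (P0 : probability Omega0 R)
    (eta : {RV P0 >-> nat}) (c : nat) : (1 < c)%N ->
  (forall delta : R, (0 < delta)%R ->
     'E_P0[fun w => ((eta w)%:R `^ delta)%R] = +oo%E)%E ->
  exists n : nat, ((4 / 2 ^+ n)%:E <= P0 [set w | (c ^ n <= eta w)%N])%E.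
Proof.
move=> c1 Einf; apply: contrapT => /forallNP small.
pose A n := [set w | (c ^ n <= eta w)%N].
have mA n : measurable (A n).
  rewrite (_ : A n = eta @^-1` [set k | (c ^ n <= k)%N])//.
  by rewrite -[X in measurable X]setTI; exact: measurable_funP.
have lnc : 0 < ln (c%:R : R) by rewrite ln_gt0// ltr1n.
pose delta : R := ln (3 / 2) / ln c%:R.
have delta0 : 0 < delta by rewrite divr_gt0// ln_gt0//; lra.
have cd : (c%:R : R) `^ delta = 3 / 2.
  rewrite /powR pnatr_eq0 gtn_eqF ?(ltn_trans _ c1)//.
  by rewrite /delta divfK ?gt_eqF// lnK// posrE; lra.
(* If [c ^ m <= eta w < c ^ m.+1], then [eta w] to the power [delta] is at most [(3 / 2) ^+ m.+1],
   which is the term [f m w]. *)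
pose f n w : \bar R := ((3 / 2) ^+ n.+1 * \1_(A n) w)%:E.
have f0 n w : (0 <= f n w)%E.
  by rewrite lee_fin mulr_ge0// exprn_ge0//; lra.
have mf n : measurable_fun setT (f n).
  apply/measurable_EFinP; apply: measurable_funM => //.
have etaf w : (((eta w)%:R `^ delta)%:E <= \sum_(0 <= n <oo) f n w)%E.
  have [->|ew] := posnP (eta w).
    by rewrite powR0 ?gt_eqF// nneseries_ge0.
  have /andP[h1 h2] := trunc_log_bounds c1 ew.
  pose m := trunc_log c (eta w).
  apply: (@le_trans _ _ (f m w)).
    have -> : f m w = ((c ^ m.+1)%N%:R `^ delta)%:E.
      rewrite /f indicE mem_set// mulr1 natrX -cd.
      by rewrite -!powR_mulrn ?powR_ge0 ?ler0n// -!powRrM mulrC.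
    rewrite lee_fin ge0_ler_powR ?nnegrE//.
    - exact: ltW.
    - by rewrite ler_nat ltnW.
  rewrite (@nneseriesD1 _ _ m)//.
  by rewrite leeDl// nneseries_ge0.
(* The integral of [f k] is at most (3/2)^(k+1) 4/2^k = 6 (3/4)^k, and these bounds sum to 24. *)
have : (+oo <= 24%:E :> \bar R)%E; last by rewrite leye_eq.
rewrite -(Einf _ delta0) unlock.
apply: (@le_trans _ _ (\int[P0]_w (\sum_(0 <= n <oo) f n w))%E).
  apply: ge0_le_integral => //.
  - apply/measurable_EFinP.
    have mg : measurable_fun [set: nat] (fun k : nat => (k%:R : R) `^ delta) by [].
    exact: (measurableT_comp mg (measurable_funP eta)).
  - exact: ge0_emeasurable_sum.
rewrite integral_nneseries//.
apply: lime_le.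
  by apply: is_cvg_nneseries => n _ _; exact: integral_ge0.
apply: nearW => n; rewrite /= big_mkord.
apply: (@le_trans _ _ (\sum_(k < n) (6 * (3 / 4) ^+ k)%:E)%E).
  apply: lee_sum => k _; rewrite /f.
  under eq_integral do rewrite EFinM.
  rewrite ge0_integralZl_EFin//; last exact/measurable_EFinP.
  rewrite integral_indic// setIT.
  apply: (@le_trans _ _ ((((3 / 2) ^+ k.+1 : R)%:E * (4 / 2 ^+ k)%:E)%E)).
    apply: lee_wpmul2l; first by rewrite lee_fin exprn_ge0//; lra.
    by rewrite leNgt; apply/negP => h; apply: (small k); exact: ltW.
  rewrite -EFinM lee_fin exprS (_ : 3 / 4 = (3 / 2) / 2); last by lra.
  rewrite !expr_div_n; lra.
rewrite sumEFin lee_fin.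
have -> : \sum_(k < n) 6 * (3 / 4) ^+ k = 24 * (1 - (3 / 4) ^+ n) :> R.
  elim: n => [|n IH]; first by rewrite big_ord0 expr0; lra.
  rewrite big_ord_recr /= IH exprS; lra.
have : 0 <= (3 / 4) ^+ n :> R by rewrite exprn_ge0//; lra.
lra.
Qed.

(** * A realization of the frog model *)

Lemma measure_preimage_nat (R : realType) (d : measure_display)
    (T : measurableType d) (mu : {measure set T -> \bar R}) (X : T -> nat) (A : set nat) :
  (forall B, measurable (X @^-1` B)) ->
  mu (X @^-1` A) = (\sum_(0 <= k <oo | k \in A) mu (X @^-1` [set k]))%E.
Proof.
move=> mX; rewrite -measure_bigcup//=.
- congr (mu _); apply/seteqP; split=> [w Aw|w [k Ak /= wk]]; first by exists (X w).
  by rewrite /= wk.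
- by move=> i j _ _ [w [/= <- <-]].
Qed.

(** * Walks driven by a sequence of choices *)

Section walk_of.
Variable G : graph.

(* c n is the position, in the list of neighbours of the current vertex, of the
   next vertex; out of range, the walk stays put. *)
Fixpoint walk_of (c : nat -> nat) (x : G) (n : nat) : G :=
  if n is n'.+1 then nth (walk_of c x n') (nbr (walk_of c x n')) (c n') else x.

Lemma walk_of_step c x n : walk_of c x n.+1 = walk_of c x n \/
  walk_of c x n.+1 \in nbr (walk_of c x n).
Proof.
have [h|h] := ltnP (c n) (size (nbr (walk_of c x n))).
  by right; exact: mem_nth.
by left; rewrite /= nth_default.
Qed.

Lemma eq_walk_of c c' x n : (forall m, (m < n)%N -> c m = c' m) ->
  walk_of c x n = walk_of c' x n.
Proof.
elim: n => [//|n IH] cc'; rewrite /= IH ?cc'//.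
by move=> m mn; apply: cc'; exact: ltnW.
Qed.

End walk_of.

(** Finer than [source_index]: every single step of a walk has its own variable. *)
Definition site_index (G : graph) : choiceType :=
  (G + (G * nat) + (G * nat * nat))%type.

Section model.
Context {R : realType} {G : graph} {d0 : measure_display} {Omega0 : measurableType d0}.
Variables (p : R) (P0 : probability Omega0 R) (eta0 : {RV P0 >-> nat}) (d : nat).
Hypothesis p01 : 0 < p < 1.
Hypothesis d_gt0 : (0 < d)%N.
Hypothesis Gd : forall x : G, deg x = d.

Definition eta_index (x : G) : site_index G := inl (inl x).
Definition life_index (x : G) (i : nat) : site_index G := inl (inr (x, i)).
Definition walk_index (x : G) (i n : nat) : site_index G := inr (x, i, n).

(** Laws of the integer codes: a lifetime is coded by its predecessor, a step by a position in the
    list of the [d] neighbours. *)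
Definition index_law (j : site_index G) (k : nat) : R :=
  match j with
  | inl (inl _) => fine (P0 (eta0 @^-1` [set k]))
  | inl (inr _) => (1 - p) * p ^+ k
  | inr _ => if (k < d)%N then d%:R^-1 else 0
  end.

Let fin_eta k : P0 (eta0 @^-1` [set k]) \is a fin_num.
Proof.
apply: fin_num_measure; rewrite -[X in measurable X]setTI; exact: measurable_funP.
Qed.

Lemma index_law_ge0 j k : 0 <= index_law j k.
Proof.
move: p01 => /andP[p0 p1].
case: j => [[x|x]|x] /=; first exact: fine_ge0.
- by rewrite mulr_ge0 ?exprn_ge0 ?subr_ge0// ltW.
- by case: ifP => _; rewrite ?invr_ge0.
Qed.

Lemma index_law_sum j : (\sum_(0 <= k <oo) (index_law j k)%:E = 1)%E.
Proof.
move: p01 => /andP[p0 p1].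
case: j => [[x|x]|x] /=.
- rewrite -(probability_setT P0) -(preimage_setT eta0) measure_preimage_nat.
    rewrite [RHS](@eq_eseriesl _ _ xpredT); last by move=> k; exact: mem_set.
    by apply: eq_eseriesr => k _; rewrite fineK.
  by move=> B; rewrite -[X in measurable X]setTI; exact: measurable_funP.
- apply/cvg_lim => //.
  have : series (geometric (1 - p) p) @ \oo --> (1 - p) / (1 - p).
    by apply: cvg_geometric_series; rewrite ger0_norm// ltW.
  rewrite divff ?subr_eq0 ?gt_eqF// => h.
  under eq_fun do rewrite sumEFin.
  exact: (cvg_comp _ _ h).
- rewrite (@nneseries_split _ _ 0 d); last by move=> k _; rewrite lee_fin; case: ifP.
  rewrite add0n [X in (_ + X)%E]eseries0 ?adde0; last first.
    by move=> k dk _; rewrite ltnNge dk.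
  rewrite big_mkord (eq_bigr (fun=> (d%:R^-1)%:E)); last by move=> i _; rewrite ltn_ord.
  by rewrite sumEFin sumr_const card_ord -(mulr_natr d%:R^-1) mulVf// pnatr_eq0 -lt0n.
Qed.


Variable Z : site_index G -> measurableTypeR R -> nat.
Hypothesis mZ : forall j A, measurable (Z j @^-1` A).
Hypothesis Zlaw : forall j k, @unit_measure R (Z j @^-1` [set k]) = (index_law j k)%:E.
Hypothesis Zrule : product_rule (@unit_measure R) Z.

Let P : probability (measurableTypeR R) R := @unit_measure R.

Lemma measurable_model_eta x : measurable_fun setT (Z (eta_index x)).
Proof. by move=> _ B _; rewrite setTI. Qed.

Definition model_eta (x : G) : {RV P >-> nat} :=
  HB.pack (Z (eta_index x)) (isMeasurableFun.Build _ _ _ _ _ (measurable_model_eta x)).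

Lemma measurable_model_life x i :
  measurable_fun setT (fun w => (Z (life_index x i) w).+1%:R%:E : \bar R).
Proof.
have mg : measurable_fun [set: nat] (fun k : nat => k.+1%:R%:E : \bar R) by [].
by apply: (measurableT_comp mg) => _ B _; rewrite setTI.
Qed.

Definition model_life (x : G) (i : nat) : {RV P >-> \bar R} :=
  HB.pack (fun w => (Z (life_index x i) w).+1%:R%:E : \bar R)
    (isMeasurableFun.Build _ _ _ _ _ (measurable_model_life x i)).

Definition model_walk (x : G) (i n : nat) (w : measurableTypeR R) : G :=
  walk_of (fun m => Z (walk_index x i m) w) x n.

Lemma model_eta_law x (A : set nat) :
  distribution P (model_eta x) A = distribution P0 eta0 A.
Proof.
rewrite /distribution /pushforward.
rewrite (measure_preimage_nat P); last exact: mZ.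
rewrite (measure_preimage_nat P0).
  apply: eq_eseriesr => k _; transitivity (index_law (eta_index x) k)%:E.
    exact: Zlaw.
  exact: fineK.
by move=> B; rewrite -[X in measurable X]setTI; exact: measurable_funP.
Qed.

Lemma model_life_law x i : is_lifetime P p (model_life x i).
Proof.
move: p01 => /andP[p0 p1]; split=> [k|pE]; last by move: p1; rewrite pE ltxx.
transitivity (index_law (life_index x i) k)%:E => //.
rewrite -Zlaw; congr unit_measure; apply/seteqP; split=> w /=.
  by move=> /eqP; rewrite eqe eqr_nat => /eqP[].
by move=> ->.
Qed.

Lemma model_walk_block x i n (D : set (measurableTypeR R)) :
  (forall w w', (forall m, (m <= n)%N -> model_walk x i m w = model_walk x i m w') ->
     D w -> D w') ->
  block_sigma Z [set walk_index x i m | m in [set m | (m < n)%N]] D.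
Proof.
move=> detD; apply: (determined_block (s := [seq walk_index x i m | m <- iota 0 n])).
  by move=> j /mapP[m]; rewrite mem_iota add0n /= => mn ->; exists m.
move=> w w' h; apply: detD => m mn; apply: eq_walk_of => l lm; apply: h.
by apply: map_f; rewrite mem_iota add0n /= (leq_trans lm mn).
Qed.

Lemma model_step_law x i n (y z : G) :
  P [set w | nth y (nbr y) (Z (walk_index x i n) w) = z] = (srw_kernel R y z)%:E.
Proof.
rewrite /srw_kernel Gd; case: ifPn => [zy|zy].
  rewrite (_ : [set w | _] = Z (walk_index x i n) @^-1` [set index z (nbr y : seq G)]).
    transitivity (index_law (walk_index x i n) (index z (nbr y : seq G)))%:E.
      exact: Zlaw.
    by rewrite /= -(Gd y) index_mem zy.
  apply/seteqP; split=> w /=; last by move=> ->; exact: (nth_index y zy).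
  (* A position out of range would return [y] itself, which is not its own neighbour. *)
  move=> zE; rewrite -zE index_uniq ?fset_uniq// ltnNge; apply/negP => h.
  by move: zy; rewrite -zE nth_default// (negPf (nbr_irr y)).
transitivity (P (Z (walk_index x i n) @^-1` [set k | nth y (nbr y) k = z])) => //.
rewrite (measure_preimage_nat P); last exact: mZ.
rewrite eseries0// => k _ /set_mem /= kz.
transitivity (index_law (walk_index x i n) k)%:E; first exact: Zlaw.
rewrite /= ifN// -leqNgt -(Gd y).
by rewrite leqNgt; apply: contra zy => h; rewrite -kz; exact: mem_nth.
Qed.

(** The path up to time [n] reads the choices before number [n], and the next step reads choice [n]
    only; independence of these blocks gives the product formula. *)
Lemma model_walk_law x i : is_simple_random_walk P x (model_walk x i).
Proof.
split.
- move=> n A; apply: (measurable_block mZ); apply: (@model_walk_block x i n).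
  by move=> w w' h; rewrite /= h.
- by rewrite -(probability_setT P); congr (P _); apply/seteqP.
move=> n v.
pose E := [set w | forall k, (k <= n)%N -> model_walk x i k w = v k].
pose F := [set w | nth (v n) (nbr (v n)) (Z (walk_index x i n) w) = v n.+1].
have -> : [set w | forall k, (k <= n.+1)%N -> model_walk x i k w = v k] = E `&` F.
  apply/seteqP; split=> w /= h.
    split; first by move=> k kn; apply: h; exact: leqW.
    by rewrite /F /= -(h n.+1)//= -(h n).
  move=> k; rewrite leq_eqVlt => /predU1P[->|]; last exact: h.1.
  by move: h => [/(_ n (leqnn n)) h1 h2]; rewrite /model_walk /= -/(model_walk x i n w) h1.
rewrite -(model_step_law x i n); apply: (block_independent mZ Zrule
  (B := [set walk_index x i m | m in [set m | (m < n)%N]]) (C := [set walk_index x i n])).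
- by apply/seteqP; split=> // j [[m /= mn <-] [mE]]; rewrite mE ltnn in mn.
- by apply: model_walk_block => w w' h Ew k kn; rewrite -h//; exact: Ew.
- apply: (determined_block (s := [:: walk_index x i n])).
    by move=> j; rewrite inE => /eqP ->.
  by move=> w w' h; rewrite /F /= h ?mem_head.
Qed.

Definition source_block (j : source_index G) : set (site_index G) :=
  match j with
  | inl (inl x) => [set eta_index x]
  | inl (inr (x, i)) => [set walk_index x i n | n in setT]
  | inr (x, i) => [set life_index x i]
  end.

Lemma source_block_disjoint j k : j != k -> source_block j `&` source_block k = set0.
Proof.
move=> jk; apply/seteqP; split=> // l [lj lk]; move/eqP: jk; apply.
case: j k lj lk => [[x|[x i]]|[x i]] [[y|[y j]]|[y j]] /=.
all: try by move=> -> [->].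
all: try by move=> -> [].
all: try by move=> [n _ <-] [].
all: try by move=> -> [->  ->].
all: try by move=> [n _ <-] [m _ [-> ->]].
Qed.

(** Each source reads only its own block of digits, and the blocks are disjoint. *)
Lemma model_independent :
  mutually_independent P (source_sigma model_eta model_walk model_life).
Proof.
move=> J E JE; apply: (@blocks_independent _ _ _ P _ Z mZ Zrule _ source_block) => //.
  exact: source_block_disjoint.
move=> j /JE; case: j => [[x|[x i]]|[x i]] /=.
- move=> [A _ <-]; apply: (determined_block (s := [:: eta_index x])).
    by move=> j; rewrite inE => /eqP ->.
  by move=> w w' h; rewrite /= h ?mem_head.
- apply: smallest_sub; first exact: smallest_sigma_algebra.
  move=> D [n _ [A _ <-]]; apply: block_sigmaS (@model_walk_block x i n _ _).
    by move=> j [m _ <-]; exists m.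
  by move=> w w' h [_ /= Aw]; split => //=; rewrite -h.
- move=> [A _ <-]; apply: (determined_block (s := [:: life_index x i])).
    by move=> j; rewrite inE => /eqP ->.
  by move=> w w' h; rewrite /= h ?mem_head.
Qed.

Definition model : frog_model G p eta0 :=
  @FrogModel R G p d0 Omega0 P0 eta0 _ _ P model_eta model_walk model_life
    model_eta_law model_walk_law model_life_law model_independent.

End model.

(** * Percolation of good vertices *)

Lemma measure_exists_le (R : realType) (d : measure_display) (T : measurableType d)
    (mu : {measure set T -> \bar R}) (L : eqType) (s : seq L) (F : L -> set T) :
  (forall l, measurable (F l)) ->
  (mu [set w | exists2 l, l \in s & F l w] <= \sum_(l <- s) mu (F l))%E.
Proof.
move=> mF; pose U (s : seq L) := [set w | exists2 l, l \in s & F l w].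
suff [] : measurable (U s) /\ (mu (U s) <= \sum_(l <- s) mu (F l))%E by [].
elim: s => [|l s [mU IH]].
  have -> : U [::] = set0 by apply/seteqP; split=> // w [].
  by rewrite measure0 big_nil.
have -> : U (l :: s) = F l `|` U s.
  apply/seteqP; split=> w.
    by move=> [k]; rewrite inE => /predU1P[->|ks] Fk; [left|right; exists k].
  by move=> [Fl|[k ks Fk]]; [exists l; rewrite ?mem_head|exists k; rewrite // inE ks orbT].
split; first exact: measurableU.
by rewrite big_cons; apply: le_trans (measureU2 _ (mF l) mU) _; exact: leeD2l.
Qed.

(** The induction step is (1 - x)(1 + (n+1)x) <= 1 + nx. The bound serves both for the particles
    missing a descendant and for the survival recursion. *)
Lemma bernoulli_inv (R : realFieldType) (x : R) (n : nat) : 0 <= x <= 1 ->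
  (1 - x) ^+ n * (1 + n%:R * x) <= 1.
Proof.
move=> /andP[x0 x1]; elim: n => [|n IH]; first by rewrite expr0 mul0r addr0 mulr1.
apply: le_trans IH; rewrite exprSr -mulrA ler_wpM2l//.
  by rewrite exprn_ge0// subr_ge0.
rewrite -natr1; have : 0 <= n%:R :> R by [].
nra.
Qed.

Lemma prode_le_expr (R : realType) (T : eqType) (s : seq T) (f : T -> \bar R) (a : R) :
  (forall x, x \in s -> 0 <= f x <= a%:E)%E -> 0 <= a ->
  (\prod_(x <- s) f x <= (a ^+ size s)%:E)%E.
Proof.
move=> fa a0.
suff /andP[] : (0 <= \prod_(x <- s) f x <= (a ^+ size s)%:E)%E by [].
elim: s fa => [|x s IH] fa; first by rewrite big_nil expr0 lee_fin ler01 lexx.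
have /andP[h1 h2] : (0 <= \prod_(x <- s) f x <= (a ^+ size s)%:E)%E.
  by apply: IH => y ys; apply: fa; rewrite inE ys orbT.
have /andP[h3 h4] := fa x (mem_head _ _).
by rewrite big_cons mule_ge0//= exprS EFinM lee_pmul.
Qed.

Section percolation.
Context {R : realType} {G : graph} {d0 : measure_display} {Omega0 : measurableType d0}.
Variables (p : R) (P0 : probability Omega0 R) (eta0 : {RV P0 >-> nat}) (d : nat).
Hypothesis p01 : 0 < p < 1.
Hypothesis Gd : forall x : G, deg x = d.
Variable Z : site_index G -> measurableTypeR R -> nat.
Hypothesis mZ : forall j A, measurable (Z j @^-1` A).
Hypothesis Zlaw : forall j k,
  @unit_measure R (Z j @^-1` [set k]) = (index_law p eta0 d j k)%:E.
Hypothesis Zrule : product_rule (@unit_measure R) Z.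

Let P : probability (measurableTypeR R) R := @unit_measure R.

Variable V : seq bool -> G.
Hypothesis VS : forall w c, V (rcons w c) \in nbr (V w).
Hypothesis V_inj : injective V.
Variables (L K : nat).
Hypothesis L_gt0 : (0 < L)%N.

(** The choice that [walk_of] has to make at time [m] on the straight way from [V w] to
    [V (w ++ u)]. *)
Definition step_position (w u : seq bool) (m : nat) : nat :=
  index (V (w ++ take m.+1 u)) (nbr (V (w ++ take m u)) : seq G).

(* The value L of the lifetime source stands for the lifetime L + 1, so that
   the particle is still active at time L. *)
Definition follow (w u : seq bool) (i : nat) : set (measurableTypeR R) :=
  [set o | Z (life_index (V w) i) o = L /\
     forall m, (m < L)%N -> Z (walk_index (V w) i m) o = step_position w u m].

(** The sources of the first [K] particles are read whether or not these are present, which makes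
    this event independent of the number of particles. *)
Definition hit_all (w : seq bool) : set (measurableTypeR R) :=
  [set o | forall u, size u = L -> exists2 i, (i < K)%N & follow w u i o].

Definition good (w : seq bool) : set (measurableTypeR R) :=
  Z (eta_index (V w)) @^-1` [set k | (K <= k)%N] `&` hit_all w.

(** Percolation to depth [n] in the 2^L-ary tree where the children of [w] are its extensions by
    words of length [L]. *)
Fixpoint alive (n : nat) (w : seq bool) : set (measurableTypeR R) :=
  if n is n'.+1 then
    good w `&` [set o | exists2 u, size u = L & alive n' (w ++ u) o]
  else setT.

Lemma take_step (w u : seq bool) (m : nat) : (m < size u)%N ->
  V (w ++ take m.+1 u) \in nbr (V (w ++ take m u)).
Proof. by move=> mu; rewrite (take_nth false)// -rcons_cat VS. Qed.

Lemma follow_walk (w u : seq bool) (i m : nat) o : size u = L ->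
  follow w u i o -> (m <= L)%N -> model_walk Z (V w) i m o = V (w ++ take m u).
Proof.
move=> uL [_ fo]; elim: m => [|m IH] mL; first by rewrite take0 cats0.
rewrite /model_walk /= -/(model_walk Z (V w) i m o) IH 1?ltnW// fo// nth_index//.
by apply: take_step; rewrite uL.
Qed.

Let life (x : G) (i : nat) (o : measurableTypeR R) : \bar R :=
  (Z (life_index x i) o).+1%:R%:E.

Lemma good_hits (w u : seq bool) o : size u = L -> good w o ->
  hits (fun x => Z (eta_index x) o) (fun x i n => model_walk Z x i n o)
    (fun x i => life x i o) (V w) (V (w ++ u)).
Proof.
move=> uL [/= Ke /(_ u uL)[i iK fo]]; exists i, L; split.
- exact: leq_trans iK Ke.
- by rewrite /life (proj1 fo) lte_fin ltr_nat.
- by rewrite (follow_walk uL fo)// take_oversize// uL.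
Qed.

Lemma alive_chain (n : nat) (w : seq bool) o : alive n w o ->
  exists ws : seq (seq bool), [/\ size ws = n,
    path (fun a b => (size a < size b)%N) w ws &
    path (fun x y => `[< hits (fun x => Z (eta_index x) o)
      (fun x i n => model_walk Z x i n o) (fun x i => life x i o) x y >])
      (V w) (map V ws)].
Proof.
elim: n w => [|n IH] w; first by exists [::].
move=> [gw [u uL /IH[ws [sws pws hws]]]]; exists ((w ++ u) :: ws); split.
- by rewrite /= sws.
- by rewrite /= pws andbT size_cat uL -{1}(addn0 (size w)) ltn_add2l.
- by rewrite /= hws andbT; apply/asboolP; exact: good_hits.
Qed.

Lemma alive_survives o : (forall n, alive n [::] o) ->
  survives (V [::]) (fun x => Z (eta_index x) o)
    (fun x i n => model_walk Z x i n o) (fun x i => life x i o).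
Proof.
move=> ao; apply: survives_chains => //.
  by move=> x i n; exact: walk_of_step.
move=> k; have [ws [sws pws hws]] := alive_chain (ao k).
exists (map V ws); split=> //; first by rewrite size_map.
(* Word lengths increase strictly along the chain, so the words, and by injectivity the vertices,
   are distinct. *)
rewrite -[_ :: _]/(map V ([::] :: ws)) map_inj_uniq//.
apply: (@sorted_uniq _ (fun a b => (size a < size b)%N)) => //.
- by move=> b a c; exact: ltn_trans.
- by move=> a; rewrite ltnn.
Qed.

(** The factor (1 - p) p^L is the probability of lifetime exactly L + 1, and the last factor that of
    [L] prescribed steps. *)
Definition follow_prob : R := (1 - p) * p ^+ L * d%:R^-1 ^+ L.

Lemma follow_probE (w u : seq bool) (i : nat) : size u = L ->
  P (follow w u i) = follow_prob%:E.
Proof.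
move=> uL.
pose A (j : site_index G) : set nat :=
  match j with inr (_, _, m) => [set step_position w u m] | _ => [set L] end.
pose s := life_index (V w) i :: [seq walk_index (V w) i m | m <- iota 0 L].
transitivity (P [set o | forall j, j \in s -> A j (Z j o)]).
  congr (P _); apply/seteqP; split=> o /=.
    move=> [ho h] j; rewrite inE => /predU1P[->//|/mapP[m]].
    by rewrite mem_iota add0n => /= mL ->; exact: h.
  move=> h; split; first by apply: (h (life_index (V w) i)); rewrite mem_head.
  move=> m mL; apply: (h (walk_index (V w) i m)); rewrite inE; apply/orP; right.
  by apply: map_f; rewrite mem_iota.
rewrite Zrule; last first.
  rewrite /= map_inj_uniq ?iota_uniq ?andbT; last by move=> a b [].
  by apply/negP => /mapP[].
rewrite big_cons big_map /= Zlaw /=.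
rewrite big_seq (eq_bigr (fun=> (d%:R^-1)%:E)); last first.
  move=> m; rewrite mem_iota add0n => /= mL; rewrite Zlaw /= -(Gd (V (w ++ take m u))).
  by rewrite index_mem take_step// uL.
rewrite -big_seq prodEFin -EFinM; congr (_ * _)%:E.
by rewrite big_const_seq count_predT size_iota iter_mulr_1.
Qed.

Definition particle_block (x : G) (i : nat) : set (site_index G) :=
  [set j | j = life_index x i \/ exists m, j = walk_index x i m].

Lemma follow_block w u i : block_sigma Z (particle_block (V w) i) (follow w u i).
Proof.
apply: (determined_block
  (s := life_index (V w) i :: [seq walk_index (V w) i m | m <- iota 0 L])).
  by move=> j; rewrite inE => /predU1P[->|/mapP[m _ ->]]; [left|right; exists m].
move=> o o' h [fo1 fo2]; split; first by rewrite -h ?mem_head.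
move=> m mL; rewrite -h ?fo2// inE; apply/orP; right; apply: map_f.
by rewrite mem_iota.
Qed.

Definition miss (w u : seq bool) : set (measurableTypeR R) :=
  [set o | forall i, i \in iota 0 K -> (~` follow w u i) o].

Lemma measurable_follow w u i : measurable (follow w u i).
Proof. exact: (measurable_block mZ (@follow_block w u i)). Qed.

Lemma measurable_miss w u : measurable (miss w u).
Proof.
rewrite (_ : miss w u = \bigcap_(i in [set i | i \in iota 0 K]) ~` follow w u i)//.
by apply: bigcap_measurableType => i _; apply: measurableC; exact: measurable_follow.
Qed.

Lemma miss_prob w u : size u = L -> P (miss w u) = ((1 - follow_prob) ^+ K)%:E.
Proof.
move=> uL; rewrite (blocks_product mZ Zrule (B := particle_block (V w))).
- rewrite (eq_bigr (fun=> (1 - follow_prob)%:E)).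
    by rewrite prodEFin big_const_seq count_predT size_iota iter_mulr_1.
  move=> i _; rewrite probability_setC; last exact: measurable_follow.
  by rewrite [X in (_ - X)%E]follow_probE.
- exact: iota_uniq.
- move=> i j ij; apply/seteqP; split=> // k [].
  move/eqP: ij => ij.
  by move=> [->|[m ->]] [|[m']] []// ?; case: ij.
- move=> i _; apply: sigma_algebraC; exact: follow_block.
Qed.


Let cells (w : seq bool) : seq (site_index G) :=
  [seq life_index (V w) i | i <- iota 0 K] ++
  [seq walk_index (V w) i m | i <- iota 0 K, m <- iota 0 L].

Lemma hit_all_determined w o o' : (forall j, j \in cells w -> Z j o = Z j o') ->
  hit_all w o -> hit_all w o'.
Proof.
move=> h ho u uL; have [i iK [fo1 fo2]] := ho u uL; exists i => //; split.
  by rewrite -h// mem_cat map_f// mem_iota.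
move=> m mL; rewrite -h ?fo2// mem_cat; apply/orP; right.
by apply: allpairs_f; rewrite mem_iota.
Qed.

Lemma hit_all_block w :
  block_sigma Z [set j | exists i, particle_block (V w) i j] (hit_all w).
Proof.
apply: determined_block (@hit_all_determined w) => j.
rewrite mem_cat => /orP[/mapP[i _ ->]|/allpairsP[[i m] [_ _ ->]]].
  by exists i; left.
by exists i; right; exists m.
Qed.

Lemma measurable_hit_all w : measurable (hit_all w).
Proof. exact: (measurable_block mZ (@hit_all_block w)). Qed.

Definition site (j : site_index G) : G :=
  match j with
  | inl (inl x) => x | inl (inr (x, _)) => x | inr (x, _, _) => x
  end.

Lemma good_block w : block_sigma Z [set j | site j = V w] (good w).
Proof.
apply: block_sigmaI.
  apply: (determined_block (s := [:: eta_index (V w)])).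
    by move=> j; rewrite inE => /eqP ->.
  by move=> o o' h; rewrite /= h ?mem_head.
by apply: block_sigmaS (@hit_all_block w) => j [i [->|[m ->]]].
Qed.

Lemma alive_block n w : block_sigma Z [set j | exists v, site j = V (w ++ v)] (alive n w).
Proof.
elim: n w => [|n IH] w; first exact: block_sigmaT.
apply: block_sigmaI.
  by apply: block_sigmaS (@good_block w) => j /= jw; exists [::]; rewrite cats0.
(* The existence of a living child is the complement of a finite conjunction, the form that
   [block_sigma_all] handles. *)
pose E := [set o | forall u : L.-tuple bool, u \in enum {: L.-tuple bool} ->
  (~` alive n (w ++ u)) o].
rewrite (_ : [set o | _] = ~` E).
  apply: sigma_algebraC; apply: block_sigma_all => u _; apply: sigma_algebraC.
  by apply: block_sigmaS (IH (w ++ u)) => j [v jv]; exists (u ++ v); rewrite catA.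
apply/seteqP; split=> o /=.
  move=> [u /eqP uL au]; rewrite /E /= => /(_ (Tuple uL)); apply => //.
  by rewrite mem_enum.
move=> nE; apply: contrapT => no; apply: nE => u _ au; apply: no.
by exists u => //; rewrite size_tuple.
Qed.

Lemma measurable_alive n w : measurable (alive n w).
Proof. exact: (measurable_block mZ (@alive_block n w)). Qed.

Hypothesis K_large : (2 ^ L)%:R * (1 - follow_prob) ^+ K <= 2^-1.
Hypothesis eta_large : ((4 / 2 ^+ L)%:E <= P0 [set o | (K <= eta0 o)%N])%E.

(** Union bound over the 2^L descendants, each missed by all [K] particles with probability
    [(1 - follow_prob) ^+ K]. *)
Lemma hit_all_prob w : ((2^-1)%:E <= P (hit_all w))%E.
Proof.
have mC : measurable (~` hit_all w) by apply: measurableC; exact: measurable_hit_all.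
have -> : hit_all w = ~` (~` hit_all w) by rewrite setCK.
rewrite probability_setC//.
suff : (P (~` hit_all w) <= (2^-1)%:E)%E.
  move=> h; rewrite leeBrDr ?fin_num_measure//; apply: le_trans (leeD2l _ h) _.
  by rewrite -EFinD lee_fin; lra.
apply: (@le_trans _ _ (P [set o | exists2 u : L.-tuple bool,
    u \in enum {: L.-tuple bool} & miss w u o])).
  apply: le_measure; rewrite ?inE//.
    rewrite (_ : [set o | _] = \bigcup_(u in [set: L.-tuple bool]) miss w u).
      by apply: fin_bigcup_measurable => // u _; exact: measurable_miss.
    by apply/seteqP; split=> o [u _ mu]; exists u => //; rewrite mem_enum.
  move=> o /= no; apply: contrapT => no'; apply: no => u /eqP uL.
  apply: contrapT => nf; apply: no'; exists (Tuple uL); first by rewrite mem_enum.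
  move=> i; rewrite mem_iota add0n /= => iK fo; apply: nf; by exists i.
apply: le_trans (measure_exists_le P (F := fun u : L.-tuple bool => miss w u)
  (enum {: L.-tuple bool}) _) _; first by move=> u; exact: measurable_miss.
rewrite (eq_bigr (fun=> ((1 - follow_prob) ^+ K)%:E)); last first.
  by move=> u _; apply: miss_prob; rewrite size_tuple.
rewrite sumEFin lee_fin big_enum /= sumr_const card_tuple card_bool.
by rewrite -[_ *+ (2 ^ L)]mulr_natl.
Qed.

(** The number of particles and their movements use disjoint indices, so the bounds 4 / 2^L and 1/2
    multiply. *)
Lemma good_prob w : ((2 / 2 ^+ L)%:E <= P (good w))%E.
Proof.
rewrite /good (block_independent mZ Zrule (B := [set eta_index (V w)])
  (C := [set j | exists i, particle_block (V w) i j])).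
- have -> : P (Z (eta_index (V w)) @^-1` [set k | (K <= k)%N]) =
      P0 [set o | (K <= eta0 o)%N].
    exact: (model_eta_law mZ Zlaw (V w) [set k | (K <= k)%N]).
  apply: (@le_trans _ _ ((4 / 2 ^+ L)%:E * (2^-1)%:E)%E).
    by rewrite -EFinM lee_fin; lra.
  by apply: lee_pmul => //; exact: hit_all_prob.
- by apply/seteqP; split=> // j [-> [i [//|[]]]].
- apply: (determined_block (s := [:: eta_index (V w)])).
    by move=> j; rewrite inE => /eqP ->.
  by move=> o o' h; rewrite /= h ?mem_head.
- exact: hit_all_block.
Qed.

(** With N = 2^L, the bound 1/N reproduces itself: the N children are independent, so none is alive
    with probability at most (1 - 1/N)^N <= 1/2, and [w] is good with probability at least 2/N. *)
Lemma alive_prob n w : ((1 / 2 ^+ L)%:E <= P (alive n w))%E.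
Proof.
have N0 : 1 <= 2 ^+ L :> R by rewrite exprn_ege1// ler1n.
elim: n w => [|n IH] w.
  by rewrite /alive probability_setT lee_fin ler_pdivrMr// ?mul1r// (lt_le_trans ltr01).
pose X := [set o | exists2 u, size u = L & alive n (w ++ u) o].
pose Y (u : L.-tuple bool) := ~` alive n (w ++ u).
pose below := [set j | exists2 u, size u = L & exists v, site j = V (w ++ u ++ v)].
have XY : X = ~` [set o | forall u, u \in enum {: L.-tuple bool} -> Y u o].
  apply/seteqP; split=> o /=.
    move=> [u /eqP uL au] /(_ (Tuple uL)); apply => //.
    by rewrite mem_enum.
  move=> nE; apply: contrapT => no; apply: nE => u _ au; apply: no.
  by exists u => //; rewrite size_tuple.
have Yblock (u : L.-tuple bool) : block_sigma Z [set j | exists v, site j = V (w ++ u ++ v)] (Y u).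
  apply: sigma_algebraC; apply: block_sigmaS (@alive_block n (w ++ u)) => j [v jv].
  by exists v; rewrite catA.
have XC : block_sigma Z below (~` X).
  rewrite XY setCK; apply: block_sigma_all => u _; apply: block_sigmaS (Yblock u).
  by move=> j [v jv]; exists u; [rewrite size_tuple|exists v].
have Xb : block_sigma Z below X by rewrite -(setCK X); exact: sigma_algebraC.
(* As [L] is positive, [w] is not one of its own descendants, so goodness of [w] and [X] use
   disjoint sites. *)
rewrite -[alive _ _]/(good w `&` X) (block_independent mZ Zrule _ (@good_block w) Xb); last first.
  apply/seteqP; split=> // j [/= jw [u uL [v]]].
  rewrite jw -{1}(cats0 w) => /V_inj/eqP; rewrite eqseq_cat// eqxx /= => /eqP h.
  by move: uL L_gt0 => <-; case: u h.
have PX : ((2^-1)%:E <= P X)%E.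
  rewrite XY probability_setC; last first.
    by rewrite -(setCK [set o | _]) -XY; exact: (measurable_block mZ XC).
  rewrite (blocks_product mZ Zrule (B := fun u : L.-tuple bool =>
      [set j | exists v, site j = V (w ++ u ++ v)])).
  - have h : (\prod_(u <- enum {: L.-tuple bool}) P (Y u) <= (2^-1)%:E)%E.
      apply: le_trans (prode_le_expr (a := 1 - 1 / 2 ^+ L) _ _) _.
      + move=> u _; rewrite measure_ge0/= /Y probability_setC; last exact: measurable_alive.
        by rewrite EFinB leeB.
      + by rewrite subr_ge0 ler_pdivrMr ?mul1r// (lt_le_trans ltr01).
      rewrite -cardE card_tuple card_bool lee_fin.
      have : 0 <= (1 / 2 ^+ L : R) <= 1.
        apply/andP; split; first by apply: divr_ge0 => //; exact: exprn_ge0.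
        by rewrite ler_pdivrMr ?mul1r// (lt_le_trans ltr01).
      move=> N01; have := @bernoulli_inv _ _ (2 ^ L)%N N01; rewrite natrX mul1r divff; last first.
        by rewrite gt_eqF// (lt_le_trans ltr01).
      lra.
    have hf : (\prod_(u <- enum {: L.-tuple bool}) P (Y u))%E \is a fin_num.
      rewrite ge0_fin_numE; first by apply: le_lt_trans h _; exact: ltry.
      by apply: prode_ge0 => u _; exact: measure_ge0.
    rewrite leeBrDr//; apply: le_trans (leeD2l _ h) _.
    by rewrite -EFinD lee_fin; lra.
  - exact: enum_uniq.
  (* Different words of the same length have no common extension, so the subtrees of the children
     are disjoint. *)
  - move=> u u' uu'; apply/seteqP; split=> // j [/= [v ->] [v']].
    move=> /V_inj/eqP; rewrite eqseq_cat// eqxx /= eqseq_cat ?size_tuple// => /andP[h _].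
    by rewrite -val_eqE/= h in uu'.
  - by move=> u _; exact: Yblock.
apply: (@le_trans _ _ ((2 / 2 ^+ L)%:E * (2^-1)%:E)%E).
  by rewrite -EFinM lee_fin; lra.
apply: lee_pmul => //; exact: good_prob.
Qed.

(** The events decrease with [n] and the bound on them is uniform, so continuity from above
    applies. *)
Lemma alive_forever_prob w : ((1 / 2 ^+ L)%:E <= P (\bigcap_n alive n w))%E.
Proof.
have : P (alive n w) @[n --> \oo] --> P (\bigcap_n alive n w).
  apply: nonincreasing_cvg_mu => //.
  - by rewrite ltey_eq fin_num_measure//; exact: measurable_alive.
  - by move=> n; exact: measurable_alive.
  - by apply: bigcap_measurableType => n _; exact: measurable_alive.
  - apply/nonincreasing_seqP => n; apply/subsetPset.
    elim: n w => [//|n IH] w' o [gw [u uL au]].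
    by split=> //; exists u => //; exact: IH.
move=> h; rewrite -(cvg_lim _ h)//; apply: lime_ge; first by apply/cvg_ex; eexists; exact: h.
by apply: nearW => n; exact: alive_prob.
Qed.

End percolation.

(** * Conclusion *)

Lemma follow_prob_large (R : realType) (p : R) (d L c : nat) :
  0 < p < 1 -> (0 < d)%N -> (0 < L)%N -> 4 * d%:R / (p * (1 - p)) <= c%:R ->
  (2 ^ L)%:R * (1 - follow_prob p d L) ^+ (c ^ L)%N <= 2^-1.
Proof.
move=> /andP[p0 p1] d0 L0 hc.
have q0 : 0 < 1 - p by rewrite subr_gt0.
have dR : 0 < d%:R :> R by rewrite ltr0n.
have pL : 0 <= p ^+ L <= 1 by rewrite exprn_ge0 ?exprn_ile1 ?ltW.
have dL : 0 <= (d%:R^-1 : R) ^+ L <= 1.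
  by rewrite exprn_ge0 ?exprn_ile1 ?invr_ge0 ?invf_le1 ?ler1n.
have rho01 : 0 <= follow_prob p d L <= 1.
  move: pL dL => /andP[? ?] /andP[? ?]; rewrite /follow_prob !mulr_ge0 ?(ltW q0)//=.
  by rewrite !mulr_ile1 ?mulr_ge0 ?(ltW q0)// lerBlDr lerDl ltW.
(* The right side is (cp/d)^L (1 - p), and cp/d >= 4/(1 - p) by the choice of [c]. Since L >= 1, (1
   - p)^L <= 1 - p and 4^L >= 2 * 2^L. *)
have Krho : 2 * 2 ^+ L <= (c ^ L)%N%:R * follow_prob p d L.
  have h4 : (4 / (1 - p)) ^+ L <= (c%:R * p / d%:R) ^+ L.
    rewrite lerXn2r ?nnegrE ?divr_ge0 ?mulr_ge0 ?(ltW p0) ?(ltW q0)//.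
    rewrite ler_pdivlMr// mulrAC ler_pdivrMr// -mulrA -ler_pdivrMr//.
    exact: mulr_gt0.
  have -> : (c ^ L)%N%:R * follow_prob p d L = (c%:R * p / d%:R) ^+ L * (1 - p).
    by rewrite /follow_prob natrX !exprMn; ring.
  apply: le_trans (ler_wpM2r (ltW q0) h4).
  rewrite expr_div_n (_ : 4 = 2 * 2 :> R); last by lra.
  rewrite exprMn mulrAC ler_pdivlMr ?exprn_gt0//.
  apply: ler_pM; rewrite ?mulr_ge0 ?exprn_ge0 ?(ltW q0)//.
    rewrite ler_wpM2r ?exprn_ge0//; case: L L0 {pL dL rho01 h4} => // L' _.
    by rewrite exprS ler_pMr// exprn_ege1// ler1n.
  case: L L0 {pL dL rho01 h4} => // L' _; rewrite exprS ler_piMr ?(ltW q0)//.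
  by rewrite exprn_ile1 ?(ltW q0)// lerBlDr lerDl ltW.
have := @bernoulli_inv _ _ (c ^ L)%N rho01.
have y0 : 0 <= (1 - follow_prob p d L) ^+ (c ^ L)%N.
  by rewrite exprn_ge0// subr_ge0; case/andP: rho01.
rewrite (natrX _ 2 L); move: y0 Krho.
set y := (1 - _) ^+ _; set z := _%:R * follow_prob p d L.
move=> y0 zN yz; have : y * (2 * 2 ^+ L) <= y * z by rewrite ler_wpM2l.
lra.
Qed.

Lemma survives_heavy_tail (R : realType) (d : nat) (Td : graph) (root : Td)
    (d0 : measure_display) (Omega0 : measurableType d0)
    (P0 : probability Omega0 R) (eta : {RV P0 >-> nat}) (p : R) :
  (3 <= d)%N -> homogeneous_tree d Td ->
  (forall delta : R, (0 < delta)%R ->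
     'E_P0[fun w => ((eta w)%:R `^ delta)%R] = +oo%E)%E ->
  0 < p < 1 -> survives_with_positive_probability root p eta.
Proof.
move=> d3 [acG Gd] Einf p01.
have d_gt0 : (0 < d)%N by exact: leq_trans d3.
have [enc enc_inj] := graph_enc Td.
have [V [V0 VS V_inj]] := binary_tree_embedding Gd root d3 acG.
(* The constant [c] is chosen before [L]: [heavy_tail] finds a suitable [L] for a given [c], and
   then K = c^L. *)
have [c c1 hc] : exists2 c : nat, (1 < c)%N & 4 * d%:R / (p * (1 - p)) <= c%:R.
  pose c := (Num.truncn (4 * d%:R / (p * (1 - p)))).+2.
  exists c => //; rewrite /c.
  apply: ltW; apply: (@lt_trans _ _ (Num.truncn (4 * d%:R / (p * (1 - p)))).+1%:R).
    exact: truncnS_gt.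
  by rewrite ltr_nat.
have [L eta_large] := heavy_tail c1 Einf.
(* For L = 0 the tail bound would be a probability of at least 4. *)
have L_gt0 : (0 < L)%N.
  rewrite lt0n; apply/eqP => L0; move: eta_large; rewrite L0 expr0 leNgt => /negP; apply.
  apply: le_lt_trans (probability_le1 _ _) _.
    rewrite -[X in measurable X]setTI.
    exact: (measurable_funP eta _ [set k | (c ^ 0 <= k)%N]).
  by rewrite lte_fin; lra.
have K_large := follow_prob_large p01 d_gt0 L_gt0 hc.
pose idx_enc (j : site_index Td) : nat + nat * nat + nat * nat * nat :=
  match j with
  | inl (inl x) => inl (inl (enc x))
  | inl (inr (x, i)) => inl (inr (enc x, i))
  | inr (x, i, n) => inr (enc x, i, n)
  end.
have idx_enc_inj : injective idx_enc.
  by move=> [[x|[x i]]|[[x i] n]] [[y|[y j]]|[[y j] m]] //= [] /enc_inj -> // -> // ->.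
have [Z [mZ Zlaw Zrule]] := exists_product_rule
  (inj_comp (pcan_inj choice.pickleK) idx_enc_inj)
  (@index_law_ge0 _ Td _ _ p _ eta d p01) (@index_law_sum _ Td _ _ p _ eta d p01 d_gt0).
exists (model p01 Gd mZ Zlaw Zrule).
have pos : (0 < @unit_measure R (\bigcap_n alive Z V L (c ^ L) n [::]))%E.
  apply: lt_le_trans (alive_forever_prob Gd mZ Zlaw Zrule VS V_inj L_gt0
    K_large eta_large [::]).
  by rewrite lte_fin divr_gt0// exprn_gt0.
apply: lt_le_trans pos _; apply: le_unit_measure => o ao.
rewrite /survival_event /= -V0; apply: (alive_survives VS V_inj L_gt0) => n.
exact: ao.
Qed.

Theorem theorem1p6 (R : realType) (d : nat) (Td : graph) (root : Td)
    (d0 : measure_display) (Omega0 : measurableType d0)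
    (P0 : probability Omega0 R) (eta : {RV P0 >-> nat}) :
  (3 <= d)%N ->
  homogeneous_tree d Td ->
  (0 < P0 [set w | (1 <= eta w)%N])%E ->
  (forall delta : R, (0 < delta)%R ->
     'E_P0[fun w => ((eta w)%:R `^ delta)%R] = +oo%E)%E ->
  critical_parameter root eta = 0%E.
Proof.
move=> d3 treeT _ Einf; apply/le_anti/andP; split; last first.
  by apply/ereal_infP => _ [p [/andP[p0 _] _] <-]; rewrite lee_fin.
apply/lee_addgt0Pr => e e0; rewrite add0e.
(* The cap 1/2 keeps [p] below 1 when [e] is large. *)
pose p := Num.min e 2^-1.
have p0 : 0 < p by rewrite lt_min e0 invr_gt0 ltr0n.
have p1 : p < 1 by rewrite gt_min; apply/orP; right; lra.
apply: (@le_trans _ _ p%:E); last by rewrite lee_fin ge_min lexx.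
apply: ereal_inf_lbound; exists p => //; split; first by rewrite !ltW.
by apply: (survives_heavy_tail root d3 treeT Einf); rewrite p0 p1.
Qed.
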